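(* The following are equivalent. (i) There exists an effective algorithm which, given group homomorphisms $\phi_j\colon\mathbb{Z}^d\to\mathbb{Z}^{d_j}$ for $j=1,\ldots,m$ (with $d,d_j,m$ arbitrary), computes the set of constraints $$\operatorname{rank}(H)\le\sum_{j=1}^m s_j\operatorname{rank}(\phi_j(H))\qquad\text{for all subgroups } H\le\mathbb{Z}^d .$$ (ii) There exists an effective algorithm to decide whether a (finite) system of polynomial equations with rational coefficients has a rational solution.
   Context: Computing the set of constraints in (i) means deciding, for given homomorphisms $\phi_1,\ldots,\phi_m$ and given integers $0\le r,r_1,\ldots,r_m\le d$, whether there exists a subgroup $H\le\mathbb{Z}^d$ with $\operatorname{rank}(H)=r$ and $\operatorname{rank}(\phi_j(H))=r_j$ for all $j$, i.e. whether $r\le\sum_{j=1}^m s_jr_j$ is one of the listed inequalities. (This is the specific list of inequalities, rather than some other list of inequalities that defines the same polytope of $s\in[0,1]^m$.) Homomorphisms are given by integer matrices. The rank of an Abelian group is the cardinality of a maximal $\mathbb{Z}$-linearly independent subset. Statement (ii) is a positive answer to Hilbert's Tenth Problem for $\mathbb{Q}$: an algorithm which, given a finite set of polynomials $f_1,\ldots,f_p\in\mathbb{Q}[x_1,\ldots,x_q]$, correctly determines whether there is some $a\in\mathbb{Q}^q$ with $f_1(a)=\cdots=f_p(a)=0$. *)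

(* Defs.v *)
From mathcomp Require Import all_boot all_order all_algebra.
From mathcomp Require Import mpoly.

Set Implicit Arguments.
Unset Strict Implicit.
Unset Printing Implicit Defensive.

Import GRing.Theory.
Local Open Scope ring_scope.

(* Algorithms are formalized as Kleene's partial recursive functions, by
   arity. *)
Inductive recfun : nat -> Type :=
| RecZero n : recfun n
| RecSucc : recfun 1
| RecProj n (i : 'I_n) : recfun n
| RecComp k n (f : recfun k) (g : 'I_k -> recfun n) : recfun n
| RecPrim n (f : recfun n) (g : recfun n.+2) : recfun n.+1
| RecMin n (f : recfun n.+1) : recfun n.

(* [rec_eval f v y]: the partial function f is defined at v, with value y.
   In [RecPrim f g] the first argument is the recursion argument, and g takes
   the predecessor, the previous value and the parameters, in this order.
   [RecMin f] searches for the least x with f (x, v) = 0, and is undefined if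
   f is undefined at some (z, v) with z smaller than x. *)
Fixpoint rec_eval n (f : recfun n) : n.-tuple nat -> nat -> Prop :=
  match f in recfun n return n.-tuple nat -> nat -> Prop with
  | RecZero _ => fun _ y => y = 0%N
  | RecSucc => fun v y => y = (thead v).+1
  | RecProj _ i => fun v y => y = tnth v i
  | RecComp k _ f g => fun v y =>
      exists w : k.-tuple nat,
        (forall i, rec_eval (g i) v (tnth w i)) /\ rec_eval f w y
  | RecPrim n f g => fun v =>
      let v' : n.-tuple nat := [tuple of behead v] in
      (fix rec_loop (x y : nat) : Prop :=
         if x is x'.+1 then
           exists z, rec_loop x' z /\ rec_eval g [tuple of x' :: z :: v'] y
         else rec_eval f v' y) (thead v)
  | RecMin _ f => fun v x =>
      rec_eval f [tuple of x :: v] 0%N /\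
      forall z, (z < x)%N -> exists y, rec_eval f [tuple of z :: v] y.+1
  end.

(* The algorithm receives the code of an instance, always halts on such a
   code, and answers 1 or 0; nothing is required on the other numbers. *)
Definition effectively_decidable (I : Type) (enc : I -> nat)
    (P : I -> Prop) : Prop :=
  exists f : recfun 1, forall x : I,
    exists b : bool, rec_eval f [tuple enc x] (nat_of_bool b) /\ (b <-> P x).

(* [CodeSeq.code] is the bijection from [seq nat] to [nat] with
   code [::] = 0 and code (n :: s) = 2 ^ n * (2 * code s + 1). *)

Definition code_int (z : int) : nat :=
  match z with Posz n => n.*2 | Negz n => n.*2.+1 end.

Definition code_rat (a : rat) : nat :=
  CodeSeq.code [:: code_int (numq a); code_int (denq a)].

Definition code_mx (p q : nat) (A : 'M[int]_(p, q)) : nat :=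
  CodeSeq.code
    [seq CodeSeq.code [seq code_int (A i k) | k <- enum 'I_q]
      | i <- enum 'I_p].

Definition is_subgroup (V : zmodType) (H : V -> Prop) : Prop :=
  H 0 /\ forall x y, H x -> H y -> H (x - y).

Definition Zindependent (V : zmodType) (s : seq V) : Prop :=
  forall c : 'I_(size s) -> int,
    \sum_(i < size s) s`_i *~ c i = 0 -> forall i, c i = 0.

(* An independent sequence is duplicate-free, so its size is the cardinality
   of the subset that it enumerates. *)
Definition max_Zindependent (V : zmodType) (H : V -> Prop) (s : seq V) : Prop :=
  [/\ forall x, x \in s -> H x,
      Zindependent s &
      forall t : seq V, (forall x, x \in t -> H x) -> Zindependent t ->
        {subset s <= t} -> {subset t <= s}].

Definition has_rank (V : zmodType) (H : V -> Prop) (r : nat) : Prop :=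
  exists2 s : seq V, max_Zindependent H s & size s = r.

Definition image_of (V W : Type) (f : V -> W) (H : V -> Prop) : W -> Prop :=
  fun y => exists2 x, H x & y = f x.

(* Elements of Z^d are row vectors, so the homomorphism given by a matrix A
   is x |-> x *m A. *)
Record rank_instance := RankInstance {
  ri_m : nat;
  ri_d : nat;
  ri_cod : 'I_ri_m -> nat;
  ri_phi : forall j : 'I_ri_m, 'M[int]_(ri_d, ri_cod j);
  ri_rank : 'I_ri_d.+1;
  ri_ranks : 'I_ri_m -> 'I_ri_d.+1
}.

Definition code_rank_instance (X : rank_instance) : nat :=
  CodeSeq.code
    [:: ri_d X; nat_of_ord (ri_rank X);
        CodeSeq.code
          [seq CodeSeq.code
                 [:: ri_cod j; nat_of_ord (ri_ranks j); code_mx (ri_phi j)]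
            | j <- enum 'I_(ri_m X)]].

Definition is_rank_constraint (X : rank_instance) : Prop :=
  exists H : 'rV[int]_(ri_d X) -> Prop,
    [/\ is_subgroup H,
        has_rank H (ri_rank X) &
        forall j : 'I_(ri_m X),
          has_rank (image_of (fun x => x *m ri_phi j) H) (ri_ranks j)].

(* A polynomial is given as a finite list of terms (coefficient, exponents);
   neither an order on the terms nor distinct exponents are required. *)
Definition poly_of_terms (q : nat) (ts : seq (rat * 'X_{1..q})) :
    {mpoly rat[q]} :=
  \sum_(t <- ts) t.1 *: 'X_[t.2].

Record poly_system := PolySystem {
  ps_q : nat;
  ps_eqs : seq (seq (rat * 'X_{1..ps_q}))
}.

Definition code_terms (q : nat) (ts : seq (rat * 'X_{1..q})) : nat :=
  CodeSeq.code
    [seq CodeSeq.code [:: code_rat t.1; CodeSeq.code (t.2 : q.-tuple nat)]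
      | t : rat * 'X_{1..q} <- ts].

Definition code_poly_system (S : poly_system) : nat :=
  CodeSeq.code
    [:: ps_q S; CodeSeq.code [seq code_terms ts | ts <- ps_eqs S]].

Definition has_rational_solution (S : poly_system) : Prop :=
  exists a : 'I_(ps_q S) -> rat,
    forall ts, ts \in ps_eqs S -> (poly_of_terms ts).@[a] = 0.

(* Main.v *)
(* From ranks to polynomials: a subspace of Q^d is the row space of a rational
   matrix M, and rank(M A_j) = r_j says that M A_j = P_j pid_(r_j) Q_j for
   some invertible P_j and Q_j, which is a polynomial system in the entries of
   M, P_j, Q_j and of the inverses.

   From polynomials to ranks: the columns of M are vectors h_i spanning the
   column space, and each constraint fixes the rank of a few integer
   combinations of them. Starting from two independent vectors e_0 and e_1,
   rank conditions on pairs force a pair of columns to be v e_0 and v e_1 for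
   the same unknown rational v. Then y e_0 + z e_1 is parallel to e_0 + x e_1
   exactly when z = x y, and a linear equation between unknowns is the
   vanishing of a combination of columns. The unknowns are indexed by the codes
   of words in the variables: as code (i :: w) = 2 ^ i * (2 * code w + 1), the
   rules v_0 = 1 and v_k = v_(2 ^ i) v_z for k = 2 ^ i * (2 * z + 1) make v_k
   the value of the monomial with code k.

   Both reductions are primitive recursive in the code of the instance. *)

Require Import Defs.
From mathcomp Require Import all_boot all_order all_algebra.
From mathcomp Require Import mpoly zify.

Set Implicit Arguments.
Unset Strict Implicit.
Unset Printing Implicit Defensive.

Import GRing.Theory Num.Theory.
Local Open Scope nat_scope.

(** * Total recursive functions of an environment *)

Definition env := nat -> nat.

Definition env_tuple n (e : env) : n.-tuple nat := [tuple e i | i < n].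

(* Only finitely many entries of the environment matter; the variable bound by
   an operator is entry 0, so that shifting the environment is definitional. *)
Definition rc (f : env -> nat) : Prop :=
  exists n, exists F : recfun n, forall e, rec_eval F (env_tuple n e) (f e).

Lemma tnth_env n e (i : 'I_n) : tnth (env_tuple n e) i = e i.
Proof. by rewrite tnth_mktuple. Qed.

Lemma rc_ext f g : f =1 g -> rc f -> rc g.
Proof. by move=> fg [n [F HF]]; exists n, F => e; rewrite -fg. Qed.

Lemma rc_at_arity f n (F : recfun n) n' :
  (forall e, rec_eval F (env_tuple n e) (f e)) -> n <= n' ->
  exists F' : recfun n', forall e, rec_eval F' (env_tuple n' e) (f e).
Proof.
move=> HF le_nn'.
exists (RecComp F (fun i => RecProj (widen_ord le_nn' i))) => e /=.
exists (env_tuple n e); split=> // i.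
by rewrite !tnth_env.
Qed.

(** Only finitely many entries matter to [f], so finitely many [s i] have to be brought to a common
    arity, the maximum [N] of theirs. *)
Lemma rc_subst (f : env -> nat) (s : nat -> env -> nat) :
  rc f -> (forall i, rc (s i)) -> rc (fun e => f (fun i => s i e)).
Proof.
move=> [n [F HF]] Hs.
have /fin_all_exists[a Ha] (i : 'I_n) : exists n', exists F' : recfun n',
    forall e, rec_eval F' (env_tuple n' e) (s i e) by exact: Hs.
pose N := \max_(i < n) a i.
have /fin_all_exists[G HG] (i : 'I_n) : exists G : recfun N,
    forall e, rec_eval G (env_tuple N e) (s i e).
  have [F' HF'] := Ha i.
  by apply: rc_at_arity HF' _; apply: (leq_bigmax i).
exists N, (RecComp F G) => e /=.
exists (env_tuple n (fun i => s i e)); split=> // i.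
by rewrite tnth_env.
Qed.

Lemma rc_var k : rc (fun e => e k).
Proof.
exists k.+1, (RecProj ord_max) => e /=.
by rewrite tnth_env.
Qed.

Definition rc1 (g : nat -> nat) := rc (fun e => g (e 0)).
Definition rc2 (g : nat -> nat -> nat) := rc (fun e => g (e 0) (e 1)).
Definition rc3 (g : nat -> nat -> nat -> nat) :=
  rc (fun e => g (e 0) (e 1) (e 2)).

Lemma rc_app1 g f : rc1 g -> rc f -> rc (fun e => g (f e)).
Proof. by move=> Hg Hf; apply: (rc_subst (s := fun _ => f) Hg). Qed.

Lemma rc_app2 g f1 f2 : rc2 g -> rc f1 -> rc f2 ->
  rc (fun e => g (f1 e) (f2 e)).
Proof.
move=> Hg H1 H2.
by apply: (rc_subst (s := fun i => if i is 0 then f1 else f2) Hg); case.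
Qed.

Lemma rc_app3 g f1 f2 f3 : rc3 g -> rc f1 -> rc f2 -> rc f3 ->
  rc (fun e => g (f1 e) (f2 e) (f3 e)).
Proof.
move=> Hg H1 H2 H3.
by apply: (rc_subst (s := fun i => nth f3 [:: f1; f2] i) Hg); case=> [|[|[]]].
Qed.

Lemma rc1_succ : rc1 succn.
Proof. by exists 1, RecSucc => e /=; rewrite /thead tnth_env. Qed.

Lemma rc_const c : rc (fun _ => c).
Proof.
elim: c => [|c IH]; first by exists 0, (RecZero 0).
exact: (rc_app1 rc1_succ IH).
Qed.

Fixpoint prec (a : nat) (s : nat -> nat -> nat) (n : nat) : nat :=
  if n is n'.+1 then s n' (prec a s n') else a.

Lemma rec_eval_prim n (A : recfun n) (S : recfun n.+2) (v : n.+1.-tuple nat)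
    (w : n.-tuple nat) (p : nat -> nat) :
  [tuple of behead v] = w -> rec_eval A w (p 0) ->
  (forall k, rec_eval S [tuple of [:: k, p k & w]] (p k.+1)) ->
  rec_eval (RecPrim A S) v (p (thead v)).
Proof.
move=> vw HA HS; rewrite /rec_eval -/rec_eval vw.
by elim: (thead v) => // k IH; exists (p k).
Qed.

(** The step is computed in an environment extended by two entries, the predecessor and the previous
    value; hence the shift of the parameters by two. *)
Lemma rc_prec (a : env -> nat) (s : env -> nat -> nat -> nat) (h : env -> nat) :
  rc a -> rc (fun e => s (fun i => e i.+2) (e 0) (e 1)) -> rc h ->
  rc (fun e => prec (a e) (s e) (h e)).
Proof.
move=> [na [A0 HA0]] [ns [S0 HS0]] Hh.
pose n := maxn na ns.
have [A HA] := rc_at_arity HA0 (leq_maxl na ns).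
have [S HS] := rc_at_arity HS0 (leq_trans (leq_maxr na ns) (leqW (leqnSn _))).
pose scons x (e : env) : env := fun i => if i is i'.+1 then e i' else x.
suff Hp : rc (fun e => prec (a (fun i => e i.+1)) (s (fun i => e i.+1)) (e 0)).
  apply: (rc_subst (s := fun i => if i is i'.+1 then fun e => e i' else h) Hp).
  by case=> // i; apply: rc_var.
exists n.+1, (RecPrim A S) => e.
have -> : e 0 = thead (env_tuple n.+1 e) by rewrite /thead tnth_env.
apply: (rec_eval_prim (w := env_tuple n (fun i => e i.+1))); last move=> k.
- apply: eq_from_tnth => i.
  by rewrite tnth_behead !tnth_env inordK // ltnS.
- exact: HA.
pose e' := scons k (scons (prec (a (fun i => e i.+1)) (s (fun i => e i.+1)) k)
  (fun i => e i.+1)).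
have := HS e'; congr (rec_eval S _ _); apply: eq_from_tnth => -[[|[|i]] Hi];
  rewrite tnth_env (tnth_nth 0) //=.
by rewrite -[LHS](tnth_env (fun i => e i.+1) (Ordinal (Hi : i < n)))
  (tnth_nth 0).
Qed.

Create HintDb rcdb.
#[local] Hint Resolve rc1_succ : rcdb.

Lemma reduction_decidable (I J : Type) (encI : I -> nat) (encJ : J -> nat)
    (P : I -> Prop) (Q : J -> Prop) (F : nat -> nat) (r : I -> J) :
  rc1 F -> (forall x, F (encI x) = encJ (r x)) ->
  (forall x, P x <-> Q (r x)) ->
  effectively_decidable encJ Q -> effectively_decidable encI P.
Proof.
move=> HF FE PQ [g Hg].
have [n [G HG]] : rc (fun e => F (e 0)) by [].
(* Only entry 0 matters, while [G] may have any arity: the other arguments are filled with zero. *)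
pose pr (i : 'I_n) : recfun 1 :=
  if i == 0 :> nat then RecProj ord0 else RecZero 1.
exists (RecComp g (fun _ : 'I_1 => RecComp G pr)) => x.
have [b [Hb HQ]] := Hg (r x); exists b; split; last by rewrite HQ PQ.
exists [tuple encJ (r x)]; split=> // i; rewrite ord1 /=.
pose e i := if i is 0 then encI x else 0.
exists (env_tuple n e); split; last by rewrite (tnth_nth 0) /= -FE; apply:
  (HG e).
by move=> [[|k] Hk]; rewrite tnth_env /pr /=.
Qed.

Ltac rc_apply :=
  lazymatch goal with
  | |- rc (fun e => ?g (@?a e) (@?b e) (@?c e)) =>
      refine (@rc_app3 g a b c _ _ _ _); [solve [auto with rcdb nocore]|..]
  | |- rc (fun e => ?g (@?a e) (@?b e)) =>
      refine (@rc_app2 g a b _ _ _); [solve [auto with rcdb nocore]|..]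
  | |- rc (fun e => ?g (@?a e)) =>
      refine (@rc_app1 g a _ _); [solve [auto with rcdb nocore]|..]
  end.
(** Placeholder, redefined once the closure lemmas for bounded sums, bounded products and tabulated
    lists are proved. *)
Ltac rc_binder := fail.
Ltac rc_step :=
  cbv beta;
  lazymatch goal with
  | |- rc (fun e => e ?k) => exact (rc_var k)
  | |- rc (fun _ => ?c) => exact (rc_const c)
  | |- rc (fun e => prec (@?a e) (@?s e) (@?h e)) =>
      refine (@rc_prec a s h _ _ _)
  | |- rc (fun e => S (@?a e)) => refine (@rc_app1 S a rc1_succ _)
  | |- _ => first [rc_binder | rc_apply]
  end.
Ltac rc_tac := rewrite /rc1 /rc2 /rc3; repeat rc_step.

(** * Primitive recursive arithmetic, bounded sums and products *)

Lemma rc2_add : rc2 addn.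
Proof.
apply: (@rc_ext (fun e => prec (e 1) (fun _ z => z.+1) (e 0))); last by rc_tac.
by move=> e; elim: (e 0) => //= k ->.
Qed.
#[local] Hint Resolve rc2_add : rcdb.

Lemma rc1_pred : rc1 predn.
Proof.
apply: (@rc_ext (fun e => prec 0 (fun k _ => k) (e 0))); last by rc_tac.
by move=> e; case: (e 0).
Qed.
#[local] Hint Resolve rc1_pred : rcdb.

Lemma rc2_sub : rc2 subn.
Proof.
apply: (@rc_ext (fun e => prec (e 0) (fun _ z => z.-1) (e 1))); last by rc_tac.
by move=> e; elim: (e 1) => [|k /= ->]; rewrite ?subn0 ?subnS.
Qed.

Lemma rc2_mul : rc2 muln.
Proof.
apply: (@rc_ext (fun e => prec 0 (fun _ z => e 1 + z) (e 0))); last by rc_tac.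
by move=> e; elim: (e 0) => //= k ->.
Qed.
#[local] Hint Resolve rc2_sub rc2_mul : rcdb.

Lemma rc2_exp : rc2 expn.
Proof.
apply: (@rc_ext (fun e => prec 1 (fun _ z => e 0 * z) (e 1))); last by rc_tac.
by move=> e; elim: (e 1) => //= k ->; rewrite expnS.
Qed.
#[local] Hint Resolve rc2_exp : rcdb.

Definition ble (x y : nat) : nat := x <= y.
Definition beq (x y : nat) : nat := x == y.
Definition cond (b x y : nat) : nat := if b is 0 then y else x.

Lemma rc2_ble : rc2 ble.
Proof.
apply: (@rc_ext (fun e => 1 - (e 0 - e 1))); last by rc_tac.
by move=> e; rewrite /ble /leq; case: (e 0 - e 1).
Qed.
#[local] Hint Resolve rc2_ble : rcdb.

Lemma rc2_beq : rc2 beq.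
Proof.
apply: (@rc_ext (fun e => ble (e 0) (e 1) * ble (e 1) (e 0))); last by rc_tac.
by move=> e; rewrite /beq eqn_leq mulnb.
Qed.

Lemma rc3_cond : rc3 cond.
Proof.
apply: (@rc_ext (fun e => prec (e 2) (fun _ _ => e 1) (e 0))); last by rc_tac.
by move=> e; case: (e 0).
Qed.
#[local] Hint Resolve rc2_beq rc3_cond : rcdb.

Definition sumf (n : nat) (f : nat -> nat) := \sum_(k < n) f k.
Definition prodf (n : nat) (f : nat -> nat) := \prod_(k < n) f k.
Definition mk (n : nat) (f : nat -> nat) := CodeSeq.code (mkseq f n).

Lemma rc_body (f : env -> nat -> nat) g :
  rc (fun e => f (fun i => e i.+1) (e 0)) -> rc g -> rc (fun e => f e (g e)).
Proof.
move=> Hf Hg.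
apply: (rc_subst (s := fun i => if i is i'.+1 then fun e => e i' else g) Hf).
by case=> // i; apply: rc_var.
Qed.

(** Serves the steps of a primitive recursion: there the parameters of [f] sit two entries deeper,
    and the index [g] may depend on the two new entries. *)
Lemma rc_body2 (f : env -> nat -> nat) g :
  rc (fun e => f (fun i => e i.+1) (e 0)) -> rc g ->
  rc (fun e => f (fun i => e i.+2) (g e)).
Proof.
move=> Hf Hg.
apply: (rc_body (f := fun e => f (fun i => e i.+2))) Hg.
apply: (rc_subst (s := fun i e => if i is i'.+1 then e i'.+3 else e 0) Hf).
by case=> [|i]; apply: rc_var.
Qed.

Lemma rc_shift (f : env -> nat) k :
  rc f -> rc (fun e => f (fun i => e (k + i))).
Proof. by move=> Hf; apply: (rc_subst Hf) => i; apply: rc_var. Qed.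

Lemma rc_sumf (f : env -> nat -> nat) h :
  rc (fun e => f (fun i => e i.+1) (e 0)) -> rc h ->
  rc (fun e => sumf (h e) (f e)).
Proof.
move=> Hf Hh.
apply: (@rc_ext (fun e => prec 0 (fun k z => z + f e k) (h e))).
  by move=> e; rewrite /sumf; elim: (h e) => [|k /= ->];
    rewrite ?big_ord0 ?big_ord_recr.
apply: (rc_prec _ _ Hh); first exact: rc_const.
apply: (rc_app2 rc2_add (rc_var 1)).
exact: rc_body2 Hf (rc_var 0).
Qed.

Lemma rc_prodf (f : env -> nat -> nat) h :
  rc (fun e => f (fun i => e i.+1) (e 0)) -> rc h ->
  rc (fun e => prodf (h e) (f e)).
Proof.
move=> Hf Hh.
apply: (@rc_ext (fun e => prec 1 (fun k z => z * f e k) (h e))).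
  by move=> e; rewrite /prodf; elim: (h e) => [|k /= ->];
    rewrite ?big_ord0 ?big_ord_recr.
apply: (rc_prec _ _ Hh); first exact: rc_const.
apply: (rc_app2 rc2_mul (rc_var 1)).
exact: rc_body2 Hf (rc_var 0).
Qed.

Definition ccons (i z : nat) := 2 ^ i * (z + z).+1.

Lemma codeE i s : CodeSeq.code (i :: s) = ccons i (CodeSeq.code s).
Proof. by rewrite /ccons addnn. Qed.

Lemma rc2_ccons : rc2 ccons.
Proof. rewrite /ccons; rc_tac. Qed.
#[local] Hint Resolve rc2_ccons : rcdb.

Lemma rc_mk (f : env -> nat -> nat) h :
  rc (fun e => f (fun i => e i.+1) (e 0)) -> rc h ->
  rc (fun e => mk (h e) (f e)).
Proof.
move=> Hf Hh.
(* [ccons] prepends, so the list is built from its last entry: round [k] adds entry [h e - k.+1]. *)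
apply: (@rc_ext (fun e =>
    prec 0 (fun k z => ccons (f e (h e - k.+1)) z) (h e))).
  move=> e; rewrite /mk; have := leqnn (h e).
  suff H k : k <= h e -> prec 0 (fun k z => ccons (f e (h e - k.+1)) z) k =
      CodeSeq.code [seq f e i | i <- iota (h e - k) k].
    by move/H => ->; rewrite subnn.
  elim: k => // k IH lt_k; rewrite [LHS]/= IH ?(ltnW lt_k) //.
  by rewrite -codeE -[in RHS](subnK lt_k) addnK /= -subSn.
apply: (rc_prec _ _ Hh); first exact: rc_const.
apply: (rc_app2 rc2_ccons _ (rc_var 1)).
apply: (rc_body2 Hf); apply: (rc_app2 rc2_sub); last by rc_tac.
exact: (rc_shift 2 Hh).
Qed.

Ltac rc_binder ::=
  lazymatch goal with
  | |- rc (fun e => sumf (@?h e) (@?f e)) => refine (@rc_sumf f h _ _)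
  | |- rc (fun e => prodf (@?h e) (@?f e)) => refine (@rc_prodf f h _ _)
  | |- rc (fun e => mk (@?h e) (@?f e)) => refine (@rc_mk f h _ _)
  end.

(** Lets counting replace bounded search: [k] is recovered as the number of indices that pass the
    test [i < k]. *)
Lemma sum_ltn_ind n k : k <= n -> \sum_(i < n) (i < k : nat) = k.
Proof.
move=> le_kn; rewrite -big_mkcond -(big_ord_widen n (fun=> 1) le_kn).
by rewrite sum1_card card_ord.
Qed.

Lemma rc2_divn : rc2 divn.
Proof.
apply: (@rc_ext (fun e => cond (e 1)
  (sumf (e 0) (fun k => ble (k.+1 * e 1) (e 0))) 0)); last by rc_tac.
move=> e; move: (e 0) (e 1) => m d; case: d => //= d.
rewrite /sumf /ble; under eq_bigr => k _ do rewrite -leq_divRL //.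
exact: sum_ltn_ind (leq_div _ _).
Qed.
#[local] Hint Resolve rc2_divn : rcdb.

Lemma rc2_modn : rc2 modn.
Proof.
apply: (@rc_ext (fun e => e 0 - e 0 %/ e 1 * e 1)); last by rc_tac.
by move=> e; rewrite {1}(divn_eq (e 0) (e 1)) addKn.
Qed.
#[local] Hint Resolve rc2_modn : rcdb.

(** * Reading list codes *)

(** The exponent of 2 in a nonzero [x]. It is the head of the coded list because the cofactor
    [2 * code s + 1] is odd. *)
Definition dhd (x : nat) := sumf x (fun i => beq (x %% 2 ^ i.+1) 0).
Definition dtl (x : nat) := x %/ 2 ^ dhd x %/ 2.
Definition ddrop (x i : nat) := prec x (fun _ z => dtl z) i.
Definition dnth (x i : nat) := dhd (ddrop x i).
Definition dsize (x : nat) := sumf x (fun i => ble 1 (ddrop x i)).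

Lemma rc1_dhd : rc1 dhd. Proof. rewrite /dhd; rc_tac. Qed.
#[local] Hint Resolve rc1_dhd : rcdb.
Lemma rc1_dtl : rc1 dtl. Proof. rewrite /dtl; rc_tac. Qed.
#[local] Hint Resolve rc1_dtl : rcdb.
Lemma rc2_ddrop : rc2 ddrop. Proof. rewrite /ddrop; rc_tac. Qed.
#[local] Hint Resolve rc2_ddrop : rcdb.
Lemma rc2_dnth : rc2 dnth. Proof. rewrite /dnth; rc_tac. Qed.
Lemma rc1_dsize : rc1 dsize. Proof. rewrite /dsize; rc_tac. Qed.
#[local] Hint Resolve rc2_dnth rc1_dsize : rcdb.

Lemma dhd_ccons i z : dhd (ccons i z) = i.
Proof.
rewrite /dhd /sumf /beq.
have Hd k : (ccons i z %% 2 ^ k.+1 == 0) = (k < i).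
  rewrite -/(_ %| _) /ccons; case: (ltnP k i) => [lt_ki|le_ik].
    by rewrite dvdn_mulr // dvdn_exp2l.
  rewrite -(subnKC le_ik) -addnS expnD dvdn_pmul2l ?expn_gt0 //.
  by rewrite expnS addnn; apply/negP => /(dvdn_trans (dvdn_mulr _ (dvdnn 2)));
    rewrite dvdn2 /= odd_double.
under eq_bigr => k _ do rewrite Hd.
apply: sum_ltn_ind; rewrite /ccons; apply:
  leq_trans (ltnW (ltn_expl i (ltnSn 1))) _.
by rewrite leq_pmulr.
Qed.

Lemma dtl_ccons i z : dtl (ccons i z) = z.
Proof.
by rewrite /dtl dhd_ccons /ccons mulKn ?expn_gt0 // divn2 addnn /=
  uphalf_double.
Qed.

Lemma ddrop_code s i : ddrop (CodeSeq.code s) i = CodeSeq.code (drop i s).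
Proof.
elim: i => [|i IH]; first by rewrite drop0.
have -> : ddrop (CodeSeq.code s) i.+1 = dtl (ddrop (CodeSeq.code s) i) by [].
rewrite IH -addn1 addnC -drop_drop.
case: (drop i s) => [|x t]; first by rewrite /dtl !div0n.
by rewrite codeE dtl_ccons /= drop0.
Qed.

Lemma dnth_code s i : dnth (CodeSeq.code s) i = nth 0 s i.
Proof.
rewrite /dnth ddrop_code -[in RHS](addn0 i) -nth_drop.
case: (drop i s) => [|x t]; last by rewrite codeE dhd_ccons.
by rewrite nth_nil /dhd /sumf big_ord0.
Qed.

Lemma size_code s : size s <= CodeSeq.code s.
Proof.
elim: s => // x s IH; rewrite codeE /ccons /=.
by apply: leq_trans (leq_pmull _ (expn_gt0 2 x)); rewrite ltnS (leq_trans IH)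
  ?leq_addr.
Qed.

Lemma dsize_code s : dsize (CodeSeq.code s) = size s.
Proof.
rewrite /dsize /sumf /ble.
under eq_bigr => i _.
  rewrite ddrop_code; have -> : (0 < CodeSeq.code (drop i s)) = (i < size s).
    rewrite -[RHS]subn_gt0 -size_drop; case: (drop i s) => // x t.
    by rewrite codeE muln_gt0 expn_gt0.
  over.
exact: sum_ltn_ind (size_code s).
Qed.

Lemma dnth0 i : dnth 0 i = 0.
Proof. by rewrite (dnth_code [::]) nth_nil. Qed.

Lemma mem_lt_code s x : x \in s -> x < CodeSeq.code s.
Proof. by move: x; apply/allP/CodeSeq.ltn_code. Qed.

(** Every number is the code of a list, and a code exceeds each entry of its list. This lets the
    code of an instance bound all the sizes in it. *)
Lemma dnth_le x i : dnth x i <= x.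
Proof.
rewrite -[x]CodeSeq.decodeK dnth_code.
case: (ltnP i (size (CodeSeq.decode x))) => [/(mem_nth 0)/mem_lt_code/ltnW //|].
by move/(nth_default 0) ->.
Qed.

(** * Ranks of subgroups of Z^d as ranks of rational matrices *)

Local Open Scope ring_scope.

Local Notation ratmx := (map_mx (intr : int -> rat)).

Lemma ratmx_mul p q l (A : 'M[int]_(p, q)) (B : 'M_(q, l)) :
  ratmx (A *m B) = ratmx A *m ratmx B.
Proof. exact: map_mxM. Qed.

Lemma clear_denominators p q (B : 'M[rat]_(p, q)) :
  exists2 D : int, D != 0 & exists A, ratmx A = D%:~R *: B.
Proof.
(* The common denominator is the product of all denominators; each numerator is multiplied by the
   denominators of the other entries. *)
exists (\prod_(x : 'I_p * 'I_q) denq (B x.1 x.2)).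
  by apply/prodf_neq0 => x _; exact: denq_neq0.
exists (\matrix_(i, k) (numq (B i k) *
  \prod_(x | x != (i, k)) denq (B x.1 x.2))).
apply/matrixP => i k; rewrite !mxE [in RHS](bigD1 (i, k)) //= !intrM mulrAC;
  congr (_ * _).
by rewrite [RHS]mulrC -[X in _ = X * _]divq_num_den mulfVK // intr_eq0
  denq_neq0.
Qed.

Definition smat c (s : seq 'rV[int]_c) : 'M[rat]_(size s, c) :=
  \matrix_(i, k) (s`_i 0 k)%:~R.

Lemma row_smat c (s : seq 'rV[int]_c) i : row i (smat s) = ratmx s`_i.
Proof. by apply/rowP => k; rewrite !mxE. Qed.

Lemma mul_smat c (s : seq 'rV[int]_c) (a : 'rV[int]_(size s)) :
  ratmx a *m smat s = ratmx (\sum_(i < size s) s`_i *~ a 0 i).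
Proof.
apply/rowP => k; rewrite !mxE summxE rmorph_sum /=.
apply: eq_bigr => i _; rewrite !mxE -rmorphM /= mulrC.
congr (_%:~R).
have -> (x : 'rV[int]_c) (z : int) : (x *~ z) 0 k = x 0 k *~ z.
  by case: z => n; rewrite /intmul ?mxE mulmxnE.
by rewrite mulrzz.
Qed.

Lemma ratmx_eq0 p q (A : 'M[int]_(p, q)) : (ratmx A == 0) = (A == 0).
Proof.
apply/eqP/eqP => [/matrixP A0|->]; last by rewrite map_mx0.
by apply/matrixP => i k; apply/eqP; move: (A0 i k); rewrite !mxE => /eqP;
  rewrite intr_eq0.
Qed.

(** A rational relation becomes integral after multiplication by a common denominator. *)
Lemma Zindependent_free c (s : seq 'rV[int]_c) :
  Zindependent s <-> row_free (smat s).
Proof.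
split=> [Hs | Hs a Ha i].
  apply: inj_row_free => u u0; have [D D0 [a Da]] := clear_denominators u.
  have : ratmx a *m smat s = 0 by rewrite Da -scalemxAl u0 scaler0.
  rewrite mul_smat => /eqP; rewrite ratmx_eq0 => /eqP /Hs a0.
  have : ratmx a == 0 by rewrite ratmx_eq0; apply/eqP/rowP => i; rewrite a0 mxE.
  by rewrite Da scaler_eq0 intr_eq0 (negPf D0) => /eqP.
have : ratmx (\row_i a i) *m smat s == 0.
  rewrite mul_smat ratmx_eq0 -[X in _ == X]Ha; apply/eqP.
  by apply: eq_bigr => k _; rewrite mxE.
by rewrite mulmx_free_eq0 // ratmx_eq0 => /eqP/rowP/(_ i); rewrite !mxE.
Qed.

(** Maximality under inclusion amounts to spanning: an element of [H] outside the span could be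
    adjoined, and an independent family inside the span is no longer than [s]. *)
Lemma max_ZindependentP c (H : 'rV[int]_c -> Prop) s :
  max_Zindependent H s <->
  [/\ forall x, x \in s -> H x, row_free (smat s) &
      forall x, H x -> (ratmx x <= smat s)%MS].
Proof.
have smat_sub (t : seq 'rV[int]_c) q (B : 'M[rat]_(q, c)) :
    (forall x, x \in t -> (ratmx x <= B)%MS) -> (smat t <= B)%MS.
  by move=> Ht; apply/row_subP => i; rewrite row_smat Ht ?mem_nth.
have sub_smat (t : seq 'rV[int]_c) x : x \in t -> (ratmx x <= smat t)%MS.
  move=> tx; have lt_xt : (index x t < size t)%N by rewrite index_mem.
  rewrite -[x in ratmx x](nth_index 0 tx).
  by rewrite (_ : index x t = Ordinal lt_xt) // -row_smat row_sub.
split=> [[HsH Hs Hmax] | [HsH Hs Hspan]].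
  split=> // [|x Hx]; first exact/Zindependent_free.
  apply/contraT => xNs.
  suff : x \in s by move/sub_smat; rewrite (negPf xNs).
  apply: (Hmax (x :: s)); last exact: mem_head.
  - by move=> y; rewrite inE => /predU1P[->|/HsH].
  - apply/Zindependent_free; rewrite -row_leq_rank /=.
    have sub : (smat s < smat (x :: s))%MS.
      rewrite ltmxE; apply/andP; split.
        by apply: smat_sub => y ys; apply: sub_smat; rewrite inE ys orbT.
      apply: contra xNs; apply: submx_trans; exact/sub_smat/mem_head.
    by apply: leq_ltn_trans (rank_ltmx sub); rewrite row_leq_rank;
      apply/Zindependent_free.
  - by move=> y ys; rewrite inE ys orbT.
split=> //; first exact/Zindependent_free.
move=> t HtH /Zindependent_free Ht sub.
(* A repeated entry would give two equal rows of a free matrix. Without repetitions, the length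
   bound on [t] yields equality of the sets. *)
have Us : uniq s.
  apply/(uniqP 0) => i k; rewrite !inE => Hi Hk eq_ik.
  have /(row_free_inj Hs)/rowP/(_ (Ordinal Hi)) :
      delta_mx (0 : 'I_1) (Ordinal Hi) *m smat s =
        delta_mx 0 (Ordinal Hk) *m smat s.
    by rewrite -!rowE !row_smat /= eq_ik.
  rewrite !mxE eqxx /= eqxx; case: eqP => [/(congr1 val) //|_ /eqP].
  by rewrite oner_eq0.
have le_ts : (size t <= size s)%N.
  rewrite -(eqP Ht) -(eqP Hs) mxrankS //; apply: smat_sub => x xt.
  exact/Hspan/HtH.
by have [_ eq_st] := uniq_min_size Us sub le_ts; move=> x; rewrite eq_st.
Qed.

(** For a subgroup [H], this says that the row space of [B] is the rational space generated by [H],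
    in a form that passes to images. *)
Definition rat_span p c (H : 'rV[int]_c -> Prop) (B : 'M[rat]_(p, c)) : Prop :=
  (forall x, H x -> (ratmx x <= B)%MS) /\
  (forall u : 'rV_c, (u <= B)%MS -> exists2 D : int, D != 0 &
     exists2 x, H x & ratmx x = D%:~R *: u).

Lemma has_rank_span p c (H : 'rV[int]_c -> Prop) (B : 'M[rat]_(p, c)) r :
  rat_span H B -> has_rank H r <-> \rank B = r.
Proof.
move=> [HB BH]; split=> [[s /max_ZindependentP[HsH Hs Hspan] <-] | <-].
  rewrite -(eqP Hs); apply/eqP; rewrite eqn_leq !mxrankS //.
    by apply/row_subP => i; rewrite row_smat; apply/HB/HsH/mem_nth.
  apply/row_subP => i; have [D D0 [x Hx xE]] := BH _ (row_sub i B).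
  have := Hspan _ Hx; rewrite xE => /(scalemx_sub (D%:~R^-1)).
  by rewrite scalerA mulVf ?intr_eq0 // scale1r.
(* A basis of the row space, scaled into [H] vector by vector, is the required maximal independent
   family. *)
have /fin_all_exists2[f Hf fE] (i : 'I_(\rank B)) : exists2 x, H x &
    (row i (row_base B) <= ratmx x)%MS.
  have [|D D0 [x Hx xE]] := BH (row i (row_base B)).
    by rewrite (submx_trans (row_sub _ _)) // eq_row_base.
  exists x => //; rewrite xE.
  by rewrite (eqmx_scale _ _) ?intr_eq0.
pose s : seq 'rV[int]_c := mktuple f.
have size_s : size s = \rank B by rewrite size_tuple.
exists s => //; apply/max_ZindependentP.
have sub : (row_base B <= smat s)%MS.
  apply/row_subP => i; apply: submx_trans (fE i) _.
  have lt_i : (i < size s)%N by rewrite size_s.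
  have -> : f i = s`_(Ordinal lt_i) by rewrite -tnth_nth tnth_mktuple.
  by rewrite -row_smat row_sub.
split=> [x|| x Hx].
- by case/mapP => i _ ->.
- by rewrite -row_leq_rank [X in (X <= _)%N]size_s (leq_trans _ (mxrankS sub))
  ?eq_row_base.
- by apply: submx_trans sub; rewrite eq_row_base; exact: HB.
Qed.

Lemma rat_span_image p c l (H : 'rV[int]_c -> Prop) (B : 'M[rat]_(p, c))
    (A : 'M[int]_(c, l)) :
  rat_span H B -> rat_span (image_of (fun x => x *m A) H) (B *m ratmx A).
Proof.
move=> [HB BH]; split=> [_ [x Hx ->] | u /submxP[v ->]].
  by rewrite ratmx_mul submxMr //; apply: HB.
have [D D0 [x Hx xE]] := BH (v *m B) (submxMl _ _).
exists D => //; exists (x *m A); first by exists x.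
by rewrite ratmx_mul xE mulmxA -scalemxAl.
Qed.

(** From [H], take the matrix of a maximal independent family; from [M], take the integer points of
    its row space. The ranks agree because rational spans are compatible with homomorphisms. *)
Lemma is_rank_constraintP X :
  is_rank_constraint X <->
  exists p (M : 'M[rat]_(p, ri_d X)), \rank M = ri_rank X /\
    forall j, \rank (M *m ratmx (ri_phi j)) = @ri_ranks X j.
Proof.
split=> [[H [[H0 HB] Hr Hj]] | [p [M [Mr Mj]]]].
  have HN x : H x -> H (- x) by move=> Hx; rewrite -sub0r; apply: HB.
  have HD x y : H x -> H y -> H (x + y).
    by move=> Hx Hy; rewrite -[y]opprK; apply: HB => //; apply: HN.
  have HZ (z : int) x : H x -> H (x *~ z).
    move=> Hx; have HMn n : H (x *+ n).
      by elim: n => [|n IH]; rewrite ?mulr0n // mulrS; apply: HD.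
    by case: z => n; [exact: HMn | apply/HN/HMn].
  have [s /max_ZindependentP[HsH Hs Hspan] _] := Hr.
  have Sp : rat_span H (smat s).
    split=> // u /submxP[v ->]; have [D D0 [a aE]] := clear_denominators v.
    exists D => //; exists (\sum_(i < size s) s`_i *~ a 0 i).
      by elim/big_ind: _ => // i _; apply/HZ/HsH/mem_nth.
    by rewrite -mul_smat aE scalemxAl.
  exists (size s), (smat s); split; first exact/(has_rank_span _ Sp).
  by move=> j; apply/(has_rank_span _ (rat_span_image _ Sp)).
pose H (x : 'rV_(ri_d X)) := is_true (ratmx x <= M)%MS.
have Sp : rat_span H M.
  split=> // u uM; have [D D0 [x xE]] := clear_denominators u.
  by exists D => //; exists x; rewrite // /H xE scalemx_sub.
exists H; split; last 2 first.
- exact/(has_rank_span _ Sp).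
- by move=> j; apply/(has_rank_span _ (rat_span_image _ Sp)).
split=> [|x y]; rewrite /H ?map_mx0 ?sub0mx //.
by rewrite map_mxB => Hx Hy; rewrite addmx_sub // eqmx_opp.
Qed.

(** * From ranks to polynomials *)

Definition int_of (x : nat) : int := if odd x then Negz x./2 else Posz x./2.

Lemma code_intK : cancel code_int int_of.
Proof. by case=> n; rewrite /int_of /= odd_double ?doubleK //= uphalf_double.
Qed.

Lemma int_ofK : cancel int_of code_int.
Proof.
move=> x; rewrite /int_of -[in RHS](odd_double_half x).
by case: (odd x).
Qed.

Lemma nth_map_enum (T : Type) (z : T) d (f : 'I_d -> T) i :
  nth z [seq f x | x <- enum 'I_d] i = oapp f z (insub i).
Proof.
case: insubP => [x lt_i <-|]; last first.
  by rewrite -leqNgt => le_di; rewrite nth_default // size_map size_enum_ord.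
by rewrite (nth_map x) ?size_enum_ord //= nth_ord_enum.
Qed.

Lemma map_enum_mkseq (T : Type) n (f : nat -> T) :
  [seq f (i : 'I_n) | i <- enum 'I_n] = mkseq f n.
Proof. by rewrite /mkseq -val_enum_ord -map_comp. Qed.

(** Each equation has [I] terms, a coefficient times two variables. An index at least [q]
    contributes no exponent, which gives linear and constant terms. *)
Definition quad_system (q T I : nat) (c : nat -> nat -> int)
    (u v : nat -> nat -> nat) : poly_system :=
  PolySystem [seq [seq ((c t i)%:~R,
      [multinom (beq l (u t i) + beq l (v t i))%N | l < q]) | i <- iota 0 I]
    | t <- iota 0 T].

Lemma code_quad_system q T I c u v :
  code_poly_system (quad_system q T I c u v) =
  ccons q (ccons (mk T (fun t => mk I (fun i =>
    ccons (ccons (code_int (c t i)) (ccons 2 0))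
      (ccons (mk q (fun l => beq l (u t i) + beq l (v t i))%N) 0)))) 0).
Proof.
rewrite /code_poly_system !codeE -map_comp;
  congr (ccons _ (ccons (CodeSeq.code _) _)).
apply: eq_map => t; rewrite /comp /code_terms -map_comp; congr CodeSeq.code.
apply: eq_map => i; cbv beta iota delta [comp fst snd].
rewrite /code_rat numq_int denq_int !codeE;
  congr (ccons _ (ccons (CodeSeq.code _) _)).
exact: map_enum_mkseq.
Qed.

(* The index q, and everything above, stands for the constant 1. *)
Definition ext_val (q : nat) (a : nat -> rat) (u : nat) : rat :=
  if (u < q)%N then a u else 1.

Lemma quad_systemP q T I c u v :
  has_rational_solution (quad_system q T I c u v) <->
  exists a : nat -> rat, forall t, (t < T)%N ->
    \sum_(i < I) (c t i)%:~R * (ext_val q a (u t i) * ext_val q a (v t i)) = 0.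
Proof.
have prod1 (a : nat -> rat) w : \prod_(l < q) a l ^+ beq l w = ext_val q a w.
  rewrite /ext_val; case: ltnP => [lt_w|le_qw].
    rewrite (bigD1 (Ordinal lt_w)) //= /beq eqxx big1 ?mulr1 // => l.
    by rewrite -val_eqE /= => /negPf ->.
  rewrite big1 // => l _; rewrite /beq; case: eqP => // lw.
  by move: (ltn_ord l); rewrite lw ltnNge le_qw.
have evalE (a : nat -> rat) (b : 'I_q -> rat) t : (forall l, b l = a l) ->
    (poly_of_terms [seq ((c t i)%:~R : rat,
      [multinom (beq l (u t i) + beq l (v t i))%N | l < q]) |
       i <- iota 0 I]).@[b] =
    \sum_(i < I) (c t i)%:~R * (ext_val q a (u t i) * ext_val q a (v t i)).
  move=> ab; rewrite /poly_of_terms big_map raddf_sum -[I in iota 0 I]subn0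
    big_mkord.
  apply: eq_bigr => i _; rewrite /= mevalZ mevalX -!prod1 -big_split /=;
    congr (_ * _).
  by apply: eq_bigr => l _; rewrite mnmE ab exprD.
split=> [[b Hb] | [a Ha]].
  exists (fun l => oapp b 0 (insub l)) => t lt_t.
  rewrite -(evalE _ b) => [|l]; last by rewrite valK.
  by apply: Hb; apply: map_f; rewrite mem_iota.
exists (fun l : 'I_q => a l) => ts /mapP[t]; rewrite mem_iota add0n => /Ha Ht
  ->.
by rewrite (evalE a).
Qed.

(** * The polynomial system of the rank factorizations *)

Local Open Scope nat_scope.

(* All matrices are padded with zeros to size n, the code of the instance,
   which bounds every dimension and rank in it. Constraint 0 is rank(H) = r,
   through the identity matrix. Entries and coefficients are codes of
   integers, so 2 and 1 stand for 1 and -1. *)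
Definition in_rk (n j : nat) : nat :=
  cond j (dnth (dnth (dnth n 2) j.-1) 1) (dnth n 1).
Definition in_ent (n j i b : nat) : nat :=
  cond j (dnth (dnth (dnth (dnth (dnth n 2) j.-1) 2) i) b)
    (2 * (beq i b * ble i.+1 (dnth n 0))).
Definition in_num (n : nat) : nat := (dsize (dnth n 2)).+1.

Definition pvar (n j tag a b : nat) : nat := ((j * 5 + tag) * n + a) * n + b.
Definition pvars (n : nat) : nat := in_num n * 5 * n * n.

(* Equation (j, 0, a, b): entry (a, b) of M A_j - P_j pid Q_j;
   (j, 1, a, b): of P_j P'_j - 1; (j, 2, a, b): of Q_j Q'_j - 1.
   The variables with tags 0..4 are the entries of P_j, P'_j, Q_j, Q'_j, M. *)
Definition eq_coef (n j tag a b i : nat) : nat :=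
  cond tag
    (cond (ble i.+1 n) 2 (beq i n * beq a b))
    (cond (ble i.+1 n) (in_ent n j i b) (ble (i - n).+1 (in_rk n j))).
Definition eq_var1 (n j tag a b i : nat) : nat :=
  cond tag
    (cond (ble i.+1 n) (pvar n j (2 * tag.-1) a i) (pvars n))
    (cond (ble i.+1 n) (pvar n 0 4 a i) (pvar n j 0 a (i - n))).
Definition eq_var2 (n j tag a b i : nat) : nat :=
  cond tag
    (cond (ble i.+1 n) (pvar n j (2 * tag.-1).+1 i b) (pvars n))
    (cond (ble i.+1 n) (pvars n) (pvar n j 2 (i - n) b)).

(** Reads [t] as the mixed radix number [((j * 3 + tag) * n + a) * n + b]. *)
Definition at_eq (f : nat -> nat -> nat -> nat -> nat -> nat -> nat)
    n t i : nat :=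
  f n (t %/ n %/ n %/ 3) (t %/ n %/ n %% 3) (t %/ n %% n) (t %% n) i.

Definition rank_to_system (n : nat) : poly_system :=
  quad_system (pvars n) (in_num n * 3 * n * n) (n + n)
    (fun t i => int_of (at_eq eq_coef n t i))
    (at_eq eq_var1 n) (at_eq eq_var2 n).

Lemma rc_rank_to_system : rc1 (fun n => code_poly_system (rank_to_system n)).
Proof.
rewrite /rc1; apply: rc_ext => [e|]; first by rewrite code_quad_system.
apply: (@rc_ext (fun e => ccons (pvars (e 0))
  (ccons (mk (in_num (e 0) * 3 * e 0 * e 0) (fun t => mk (e 0 + e 0) (fun i =>
    ccons (ccons (at_eq eq_coef (e 0) t i) (ccons 2 0))
      (ccons (mk (pvars (e 0))
        (fun l => beq l (at_eq eq_var1 (e 0) t i) +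
          beq l (at_eq eq_var2 (e 0) t i))) 0)))) 0))).
  move=> e /=; congr (ccons _ (ccons (CodeSeq.code _) _)); apply: eq_map => t.
  congr CodeSeq.code; apply: eq_map => i; by rewrite int_ofK.
rewrite /at_eq /eq_coef /eq_var1 /eq_var2 /in_ent /in_rk /pvar /pvars /in_num.
rc_tac.
Qed.

Local Open Scope ring_scope.

Definition in_mx (n j : nat) : 'M[rat]_n :=
  \matrix_(i, b) (int_of (in_ent n j i b))%:~R.

(** Gaussian elimination provides the factors. Conversely, the one-sided inverses make [P] and [Q]
    invertible, and [pid_mx k] has rank [k] as [k <= n]. *)
Lemma rank_factorP n (B : 'M[rat]_n) k : (k <= n)%N ->
  \rank B = k <-> exists P P' Q Q' : 'M_n,
    [/\ B = P *m pid_mx k *m Q, P *m P' = 1%:M & Q *m Q' = 1%:M].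
Proof.
move=> le_kn; split=> [<- | [P [P' [Q [Q' [-> PP' QQ']]]]]].
  exists (col_ebase B), (invmx (col_ebase B)), (row_ebase B),
    (invmx (row_ebase B)).
  by rewrite mulmx_ebase !mulmxV ?col_ebase_unit ?row_ebase_unit.
have [uP _] := mulmx1_unit PP'; have [uQ _] := mulmx1_unit QQ'.
rewrite mxrankMfree ?row_free_unit // (eqmxMfull _ _) ?row_full_unit //.
exact: rank_pid_mx.
Qed.

Lemma in_rk_le n j : (in_rk n j <= n)%N.
Proof.
rewrite /in_rk; case: j => [|j] /=; first exact: dnth_le.
by do 2![apply: leq_trans (dnth_le _ _) _]; exact: dnth_le.
Qed.

Lemma pvar_lt n j tag a b : (j < in_num n)%N -> (tag < 5)%N -> (a < n)%N ->
  (b < n)%N -> (pvar n j tag a b < pvars n)%N.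
Proof.
move=> hj ht ha hb; rewrite /pvar /pvars.
have h1 : (j * 5 + tag < in_num n * 5)%N by lia.
have h2 : ((j * 5 + tag) * n + a < in_num n * 5 * n)%N by nia.
by nia.
Qed.

Lemma divmod_digit n x y : (y < n)%N ->
  ((x * n + y) %/ n = x)%N * ((x * n + y) %% n = y)%N.
Proof.
move=> lt_yn; split; last by rewrite modnMDl modn_small.
by rewrite divnMDl ?divn_small ?addn0 //; apply: leq_ltn_trans lt_yn.
Qed.

Lemma ext_val_out q a : ext_val q a q = 1.
Proof. by rewrite /ext_val ltnn. Qed.

Lemma rank_to_systemP n : has_rational_solution (rank_to_system n) <->
  exists M : 'M[rat]_n, forall j, (j < in_num n)%N ->
    \rank (M *m in_mx n j) = in_rk n j.
Proof.
pose mx (a : nat -> rat) j tag : 'M[rat]_n :=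
  \matrix_(x, y) a (pvar n j tag x y).
pose lhs (a : nat -> rat) j tag : 'M[rat]_n :=
  if tag is 0 then
    mx a 0%N 4 *m in_mx n j - mx a j 0%N *m pid_mx (in_rk n j) *m mx a j 2
  else mx a j (2 * tag.-1)%N *m mx a j (2 * tag.-1).+1%N - 1%:M.
have ext_in a j tag x y : (j < in_num n)%N -> (tag < 5)%N -> (x < n)%N ->
    (y < n)%N -> ext_val (pvars n) a (pvar n j tag x y) = a (pvar n j tag x y).
  by move=> *; rewrite /ext_val pvar_lt.
have lhsE a j tag (x y : 'I_n) : (j < in_num n)%N -> (tag < 3)%N ->
  \sum_(i < n + n) (int_of (eq_coef n j tag x y i))%:~R *
    (ext_val (pvars n) a (eq_var1 n j tag x y i) *
     ext_val (pvars n) a (eq_var2 n j tag x y i)) = lhs a j tag x y.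
  move=> lt_j lt_tag; rewrite big_split_ord /=.
  (* The terms with [i < n] form the first product. The others subtract: for tag 0 the product
     through [pid_mx]; otherwise only [i = n] survives and gives the entry of the identity. *)
  case: tag lt_tag => [|tag] lt_tag; rewrite /lhs /eq_coef /eq_var1 /eq_var2 /=.
    rewrite [RHS]mxE [in RHS]mxE; congr (_ + _).
      apply: eq_bigr => i _; rewrite /ble ltn_ord /= ext_val_out ext_in //.
      by rewrite !mxE mulr1 mulrC.
    rewrite mxE [in RHS]mxE -sumrN; apply: eq_bigr => i _.
    rewrite /ble ltnNge leq_addr /= addKn !ext_in // mxE.
    rewrite (bigD1 i) //= big1 ?addr0 => [|l /negPf neq_li]; last first.
      by rewrite [in X in _ * X]mxE val_eqE neq_li mulr0.
    rewrite !mxE eqxx /=; case: ltnP => _ /=; rewrite ?mulr1 ?mulr0 ?mul0r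
      ?oppr0 //.
    by rewrite mulN1r.
  rewrite [RHS]mxE [in RHS]mxE; congr (_ + _).
    apply: eq_bigr => i _; rewrite /ble ltn_ord /= mul1r !ext_in //; try lia.
    by rewrite !mxE.
  rewrite !mxE; case: n x y {mx lhs ext_in} lt_j => [[] //|n'] x y lt_j.
  rewrite big_ord_recl big1 /= => [|i _]; last first.
    by rewrite /ble /beq ltnNge leq_addr /=
      -[X in (_ == X)%N]addn0 eqn_add2l mul0r.
  rewrite /ble ltnNge leq_addr /=
    ext_val_out addn0 /beq eqxx mul1n !mulr1 addr0.
  by rewrite val_eqE; case: eqP => //= _; rewrite oppr0.
rewrite /rank_to_system quad_systemP.
transitivity (exists a, forall j tag, (j < in_num n)%N -> (tag < 3)%N ->
    lhs a j tag = 0).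
  split=> -[a Ha]; exists a.
    move=> j tag lt_j lt_tag; apply/matrixP => x y; rewrite -lhsE // mxE.
    pose t := (((j * 3 + tag) * n + x) * n + y)%N.
    have lt_t : (t < in_num n * 3 * n * n)%N.
      have h1 : (j * 3 + tag < in_num n * 3)%N by lia.
      have h2 : ((j * 3 + tag) * n + x < in_num n * 3 * n)%N.
        by have := ltn_ord x; nia.
      by rewrite /t; have := ltn_ord y; nia.
    by have := Ha t lt_t; rewrite /at_eq /t !divmod_digit.
  move=> t lt_t; rewrite /at_eq.
  have n0 : (0 < n)%N by move: lt_t; case: (n) => //; rewrite muln0.
  rewrite -[(t %/ n %% n)%N]/(val (Ordinal (ltn_pmod (t %/ n)%N n0))).
  rewrite -[(t %% n)%N]/(val (Ordinal (ltn_pmod t n0))).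
  have lt_j : (t %/ n %/ n %/ 3 < in_num n)%N by rewrite !ltn_divLR.
  have lt_tag : (t %/ n %/ n %% 3 < 3)%N by rewrite ltn_pmod.
  by rewrite lhsE // Ha // mxE.
split=> [[a Ha] | [M HM]].
  exists (mx a 0%N 4) => j lt_j; apply/(rank_factorP _ (in_rk_le _ _)).
  exists (mx a j 0%N), (mx a j 1%N), (mx a j 2), (mx a j 3); split; apply/eqP.
  - by rewrite -subr_eq0; apply/eqP/(Ha j 0%N).
  - by rewrite -subr_eq0; apply/eqP/(Ha j 1%N).
  - by rewrite -subr_eq0; apply/eqP/(Ha j 2).
have /fin_all_exists[F HF] (j : 'I_(in_num n)) : exists F : nat -> 'M[rat]_n,
    [/\ M *m in_mx n j = F 0%N *m pid_mx (in_rk n j) *m F 2,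
        F 0%N *m F 1%N = 1%:M & F 2 *m F 3 = 1%:M].
  have /(rank_factorP _ (in_rk_le _ _))[P [P' [Q [Q' H]]]] := HM _ (ltn_ord j).
  by exists (fun i => nth 0 [:: P; P'; Q; Q'] i).
(* All the matrices are assembled into one assignment, which decodes a variable index into block,
   tag, row and column; values out of range are 0. *)
pose a0 j tag : 'M_n := if tag == 4 then M else oapp F (fun=> 0) (insub j) tag.
pose a w := let j := (w %/ n %/ n %/ 5)%N in let tag := (w %/ n %/ n %% 5)%N in
  oapp (fun x => oapp (fun y => a0 j tag x y) 0 (insub (w %% n)%N)) 0
    (insub (w %/ n %% n)%N).
have mxE' j tag : (tag < 5)%N -> mx a j tag = a0 j tag.
  move=> lt_tag; apply/matrixP => x y; rewrite mxE /a /pvar.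
  by rewrite !divmod_digit // !valK.
exists a => j tag lt_j lt_tag.
have [H0 H1 H2] := HF (Ordinal lt_j).
by case: tag lt_tag => [|[|[|]]] // _; rewrite /lhs !mxE' // /a0 /= ?insubT /=
  ?H0 ?H1 ?H2 subrr.
Qed.

Lemma mul_pid_mxE n d c (A : 'M[rat]_(d, c)) (i : 'I_n) y :
  ((pid_mx d : 'M_(n, d)) *m A) i y = oapp (fun x => A x y) 0 (insub (i : nat)).
Proof.
rewrite mxE; case: insubP => [x lt_i xi | /negPf nlt_i] /=.
  rewrite (bigD1 x) //= big1 => [|l neq_lx]; rewrite mxE -xi.
    by rewrite eqxx ltn_ord mul1r addr0.
  by rewrite val_eqE eq_sym (negPf neq_lx) mul0r.
by rewrite big1 // => l _; rewrite mxE nlt_i andbF mul0r.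
Qed.

Lemma mulmx_pidE n d c (A : 'M[rat]_(d, c)) x (b : 'I_n) :
  (A *m (pid_mx c : 'M_(c, n))) x b = oapp (A x) 0 (insub (b : nat)).
Proof.
have -> : A *m pid_mx c = ((pid_mx c : 'M_(n, c)) *m A^T)^T.
  by rewrite trmx_mul tr_pid_mx trmxK.
by rewrite mxE mul_pid_mxE; case: insub => //= y; rewrite mxE.
Qed.

Lemma pid_row_full n d : (d <= n)%N -> row_full (pid_mx d : 'M[rat]_(n, d)).
Proof. by move=> le_dn; rewrite /row_full rank_pid_mx. Qed.

Lemma pid_row_free n d : (d <= n)%N -> row_free (pid_mx d : 'M[rat]_(d, n)).
Proof. by move=> le_dn; rewrite /row_free rank_pid_mx. Qed.

Section Instance.
Variable X : rank_instance.
Let n := code_rank_instance X.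
Let d := ri_d X.

Lemma in_dimE : dnth n 0 = d.
Proof. by rewrite /n /code_rank_instance dnth_code. Qed.

Lemma in_dim_le : (d <= n)%N.
Proof. by rewrite -in_dimE dnth_le. Qed.

Lemma in_rk0 : in_rk n 0 = ri_rank X.
Proof. by rewrite /in_rk /= /n /code_rank_instance dnth_code. Qed.

Lemma in_numE : in_num n = (ri_m X).+1.
Proof. by rewrite /in_num /n /code_rank_instance dnth_code dsize_code size_map
  size_enum_ord. Qed.

Lemma in_mapE (j : 'I_(ri_m X)) : dnth (dnth n 2) j =
  CodeSeq.code [:: ri_cod j; nat_of_ord (ri_ranks j); code_mx (ri_phi j)].
Proof.
by rewrite {1}/n /code_rank_instance !dnth_code nth_map_enum valK.
Qed.

Lemma in_rkS (j : 'I_(ri_m X)) : in_rk n j.+1 = ri_ranks j.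
Proof. by rewrite /in_rk /= in_mapE dnth_code. Qed.

Lemma in_cod_le (j : 'I_(ri_m X)) : (ri_cod j <= n)%N.
Proof.
have -> : ri_cod j = dnth (dnth (dnth n 2) j) 0 by rewrite in_mapE dnth_code.
by do 2![apply: leq_trans (dnth_le _ _) _]; exact: dnth_le.
Qed.

Lemma in_mx0 : in_mx n 0 = (pid_mx d : 'M_(n, d)) *m pid_mx d.
Proof.
apply/matrixP => i b; rewrite mxE mul_pid_mxE /in_ent /= in_dimE /beq /ble.
rewrite mul2n -[X in int_of X]/(code_int (Posz _)) code_intK.
case: insubP => [x lt_i xi | /negPf nlt_i] /=.
  by rewrite mxE xi lt_i muln1 andbT.
by rewrite nlt_i muln0.
Qed.

Lemma in_mxS (j : 'I_(ri_m X)) :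
  in_mx n j.+1 =
  (pid_mx d : 'M_(n, d)) *m ratmx (ri_phi j) *m pid_mx (ri_cod j).
Proof.
apply/matrixP => i b; rewrite mxE mulmx_pidE /in_ent /= in_mapE dnth_code /=.
rewrite /code_mx dnth_code nth_map_enum.
(* Reading outside a list yields 0, the code of the integer 0, so the padding consists of zeros. *)
case: (insubP _ (b : nat)) => [y lt_b yb|nlt_b] /=; rewrite ?mul_pid_mxE;
  case: insubP => [x lt_i xi|nlt_i] /=; rewrite ?dnth_code ?nth_map_enum -?yb
    ?valK /= ?code_intK ?mxE //.
- by rewrite dnth0.
- by rewrite insubN.
- by rewrite dnth0.
Qed.

Lemma is_rank_constraint_in_mx :
  is_rank_constraint X <->
  exists M : 'M[rat]_n, forall j, (j < in_num n)%N ->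
    \rank (M *m in_mx n j) = in_rk n j.
Proof.
pose E : 'M[rat]_(n, d) := pid_mx d.
have fullE : row_full E := pid_row_full in_dim_le.
have free_d := pid_row_free in_dim_le.
have rk0 (M : 'M_n) : \rank (M *m in_mx n 0) = \rank (M *m E).
  by rewrite in_mx0 mulmxA mxrankMfree.
have rkS (M : 'M_n) (j : 'I_(ri_m X)) :
    \rank (M *m in_mx n j.+1) = \rank (M *m E *m ratmx (ri_phi j)).
  by rewrite in_mxS !mulmxA mxrankMfree // pid_row_free // in_cod_le.
rewrite is_rank_constraintP; split=> [[p [M [Mr Mj]]] | [M HM]].
  (* [M] may have any number of rows: [<<M>>%MS] is a square matrix with the same row space, and
     fits into size [n]. *)
  exists (E *m <<M>>%MS *m pid_mx d).
  have EE : pid_mx d *m E = 1%:M.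
    by rewrite /E mul_pid_mx minnn (minn_idPr in_dim_le) pid_mx_1.
  have eqM : E *m <<M>>%MS *m pid_mx d *m E = E *m <<M>>%MS.
    by rewrite -mulmxA EE mulmx1.
  case=> [_|j lt_j].
    by rewrite rk0 eqM in_rk0 -Mr (eqmxMfull _ fullE) genmxE.
  have {}lt_j : (j < ri_m X)%N by rewrite -ltnS -in_numE.
  rewrite -[j]/(val (Ordinal lt_j)) in_rkS rkS eqM -Mj -mulmxA
    (eqmxMfull _ fullE).
  by rewrite (eqmxMr _ (genmxE M)).
exists n, (M *m E); split; first by rewrite -rk0 HM // in_rk0.
by move=> j; rewrite -rkS HM ?in_numE ?ltnS // in_rkS.
Qed.

End Instance.

Lemma system_decides_rank :
  effectively_decidable code_poly_system has_rational_solution ->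
  effectively_decidable code_rank_instance is_rank_constraint.
Proof.
apply: (reduction_decidable (F := fun n => code_poly_system (rank_to_system n))
  (r := fun X => rank_to_system (code_rank_instance X))) => [|//|X].
  exact: rc_rank_to_system.
by rewrite is_rank_constraint_in_mx rank_to_systemP.
Qed.

(** * From polynomials to ranks *)

Local Open Scope nat_scope.

(** The code of the word in which letter [i] occurs as often as entry [i] of the exponent list [e]
    says: the index of the register of that monomial. *)
Definition word (e : nat) : nat :=
  prec 0 (fun i acc => prec acc (fun _ z => ccons i z) (dnth e i)) (dsize e).

Definition eq_num (n : nat) : nat := dsize (dnth n 1).
Definition term_num (n s : nat) : nat := dsize (dnth (dnth n 1) s).
Definition term (n s t : nat) : nat := dnth (dnth (dnth n 1) s) t.
Definition term_word (n s t : nat) : nat := word (dnth (term n s t) 1).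
Definition term_numer (n s t : nat) : nat := dnth (dnth (term n s t) 0) 0.
(** A denominator is positive, so its code as an integer is twice its value. *)
Definition term_denom (n s t : nat) : nat := dnth (dnth (term n s t) 0) 1 %/ 2.
(* Absolute value of the coefficient, after clearing the denominators of the
   polynomial. *)
Definition term_abs (n s t : nat) : nat :=
  cond (term_numer n s t %% 2) (term_numer n s t %/ 2).+1
    (term_numer n s t %/ 2)
  * prodf (term_num n s) (fun t' => cond (beq t' t) 1 (term_denom n s t')).

Lemma rc1_word : rc1 word. Proof. rewrite /word; rc_tac. Qed.
#[local] Hint Resolve rc1_word : rcdb.
Lemma rc3_term : rc3 term. Proof. rewrite /term; rc_tac. Qed.
#[local] Hint Resolve rc3_term : rcdb.
Lemma rc1_eq_num : rc1 eq_num. Proof. rewrite /eq_num; rc_tac. Qed.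
Lemma rc2_term_num : rc2 term_num. Proof. rewrite /term_num; rc_tac. Qed.
Lemma rc3_term_word : rc3 term_word. Proof. rewrite /term_word; rc_tac. Qed.
Lemma rc3_term_numer : rc3 term_numer. Proof. rewrite /term_numer; rc_tac. Qed.
Lemma rc3_term_denom : rc3 term_denom. Proof. rewrite /term_denom; rc_tac. Qed.
#[local] Hint Resolve rc1_eq_num rc2_term_num rc3_term_word rc3_term_numer
  rc3_term_denom : rcdb.
Lemma rc3_term_abs : rc3 term_abs. Proof. rewrite /term_abs; rc_tac. Qed.
#[local] Hint Resolve rc3_term_abs : rcdb.

Definition code_sub (p m : nat) : nat :=
  cond (ble m p) (2 * (p - m)) (2 * (m - p)).-1.

Lemma int_of_code_sub p m : int_of (code_sub p m) = (Posz p - Posz m)%R.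
Proof.
rewrite /code_sub /ble; case: leqP => [le_mp|lt_pm] /=.
  by rewrite mul2n -[X in int_of X]/(code_int (Posz _)) code_intK subzn.
have -> : (2 * (m - p)).-1 = code_int (Negz (m - p).-1).
  by rewrite /= -[in LHS](ltn_predK lt_pm); lia.
by rewrite code_intK NegzE; lia.
Qed.

(* Code of the coefficient of the register l in equation s. *)
Definition lin_coef (n s l : nat) : nat :=
  code_sub
    (sumf (term_num n s) (fun t => beq (term_word n s t) l *
       (cond (term_numer n s t %% 2) 0 (term_abs n s t))))
    (sumf (term_num n s) (fun t => beq (term_word n s t) l *
       (cond (term_numer n s t %% 2) (term_abs n s t) 0))).

(** Exceeds the number of equations and the code of every monomial that occurs; the final successor
    makes register 0 exist in all cases. *)
Definition reg_num (n : nat) : nat :=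
  (eq_num n + sumf (eq_num n) (fun s => sumf (term_num n s)
     (fun t => (term_word n s t).+1))).+1.

Definition sel (tag x0 x1 x2 x3 x4 : nat) : nat :=
  cond (beq tag 0) x0 (cond (beq tag 1) x1 (cond (beq tag 2) x2
    (cond (beq tag 3) x3 x4))).

(* The subgroup is generated by the rows of a matrix whose columns 2k and
   2k + 1 should be v_k e_0 and v_k e_1. Constraint (k, tag) with tag < 5
   bears on the span of two vectors, each the sum of at most two columns (the
   index 2 * reg_num n stands for 0):
     0: e_0, e_1
     1: v_k e_0, e_0
     2: v_k e_1, e_1
     3: v_k e_0 + v_k e_1, e_0 + e_1
     4: v_z e_0 + v_k e_1, e_0 + v_(2 ^ i) e_1  for k = 2 ^ i * (2 z + 1),
   and constraint (k, 5) says that equation k vanishes on the v_l e_0. *)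
Definition left1 (n k tag : nat) : nat :=
  sel tag 0 (2 * k) (2 * k).+1 (2 * k) (2 * dtl k).
Definition left2 (n k tag : nat) : nat :=
  sel tag (2 * reg_num n) (2 * reg_num n) (2 * reg_num n) (2 * k).+1 (2 * k).+1.
Definition right1 (n k tag : nat) : nat := sel tag 1 0 1 0 0.
Definition right2 (n k tag : nat) : nat :=
  sel tag (2 * reg_num n) (2 * reg_num n) (2 * reg_num n) 1
    (2 * cond k (2 ^ dhd k) 0).+1.
Definition entry (n k tag i c : nat) : nat :=
  cond (beq tag 5)
    (cond c 0 (cond (i %% 2) 0 (lin_coef n k (i %/ 2))))
    (cond c
       (2 * (beq i (right1 n k tag) + beq i (right2 n k tag)))
       (2 * (beq i (left1 n k tag) + beq i (left2 n k tag)))).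
Definition target_rank (tag : nat) : nat :=
  cond (beq tag 0) 2 (cond (beq tag 5) 0 1).

Definition system_to_rank (n : nat) : rank_instance :=
  @RankInstance (reg_num n * 6) (2 * reg_num n) (fun=> 2)
    (fun t => \matrix_(i, c) int_of (entry n (t %/ 6) (t %% 6) i c))%R
    (inord 2) (fun t => inord (target_rank (t %% 6))).

Lemma inord_rank n r : r <= 2 ->
  nat_of_ord (inord r : 'I_(2 * reg_num n).+1) = r.
Proof. by move=> le_r; rewrite inordK // ltnS (leq_trans le_r) // leq_pmulr.
Qed.

Lemma target_rank_le tag : target_rank tag <= 2.
Proof. by case: tag => [|[|[|[|[|[|]]]]]]. Qed.

Lemma code_system_to_rank n : code_rank_instance (system_to_rank n) =
  ccons (2 * reg_num n) (ccons 2 (ccons (mk (reg_num n * 6) (fun t =>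
    ccons 2 (ccons (target_rank (t %% 6)) (ccons (mk (2 * reg_num n) (fun i =>
      mk 2 (fun c => entry n (t %/ 6) (t %% 6) i c))) 0)))) 0)).
Proof.
rewrite /code_rank_instance !codeE inord_rank //.
congr (ccons _ (ccons _ (ccons (CodeSeq.code _) _))).
rewrite -(map_enum_mkseq _); apply: eq_map => t.
rewrite !codeE inord_rank ?target_rank_le //.
congr (ccons _ (ccons _ (ccons (CodeSeq.code _) _))).
rewrite -(map_enum_mkseq _); apply: eq_map => i.
congr CodeSeq.code; rewrite -(map_enum_mkseq _); apply: eq_map => c.
by rewrite mxE int_ofK.
Qed.

Lemma rc_system_to_rank : rc1 (fun n => code_rank_instance (system_to_rank n)).
Proof.
rewrite /rc1; apply: rc_ext => [e|]; first by rewrite code_system_to_rank.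
have rc_lin : rc3 lin_coef by rewrite /lin_coef /code_sub; rc_tac.
have rc_reg : rc1 reg_num by rewrite /reg_num; rc_tac.
rewrite /target_rank /entry /left1 /left2 /right1 /right2 /sel.
rc_tac.
Qed.

(** * Ranks of pairs of columns *)

Local Open Scope ring_scope.

Definition rank2 p (u w : 'cV[rat]_p) : nat := \rank (row_mx u w).

Lemma mxrank2E p (B : 'M[rat]_(p, 2)) :
  \rank B = rank2 (col ord0 B) (col ord_max B).
Proof.
congr (\rank _); apply/matrixP => x y; rewrite [RHS]mxE.
case: splitP => k ky; rewrite !mxE; congr (B _ _); apply: val_inj => /=;
  by rewrite ky ord1.
Qed.

Lemma rank2_tr p (u w : 'cV[rat]_p) : rank2 u w = \rank (u^T + w^T)%MS.
Proof. by rewrite /rank2 -mxrank_tr tr_row_mx addsmxE. Qed.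

Lemma rank2_eq1 p (u w : 'cV[rat]_p) : w != 0 ->
  rank2 u w = 1%N <-> exists c, u = c *: w.
Proof.
move=> w0; have rw : \rank w^T = 1%N.
  by rewrite mxrank_tr; apply/eqP; rewrite eqn_leq rank_leq_col lt0n mxrank_eq0.
rewrite rank2_tr; split=> [Hr | [c ->]]; last first.
  by rewrite linearZ /= (addsmx_idPr _) ?rw // scalemx_sub.
have : (w^T == u^T + w^T)%MS.
  by rewrite -(mxrank_leqif_eq (addsmxSr _ _)) rw Hr.
case/andP=> _; rewrite addsmx_sub => /andP[/sub_rVP[c uE] _].
by exists c; rewrite -[u]trmxK uE linearZ /= trmxK.
Qed.

Lemma rank2_eq0 p (u : 'cV[rat]_p) : rank2 u 0 = 0%N <-> u = 0.
Proof.
rewrite rank2_tr trmx0 addsmx0 mxrank_tr; split=> [/eqP|->].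
  by rewrite mxrank_eq0 => /eqP.
by rewrite mxrank0.
Qed.

Lemma rank2_eq2 p (u w : 'cV[rat]_p) : rank2 u w = 2%N ->
  forall x y, x *: u + y *: w = 0 -> x = 0 /\ y = 0.
Proof.
move=> Hr x y xy0.
have free : row_free (col_mx u^T w^T).
  by rewrite /row_free -addsmxE -rank2_tr Hr.
have : row_mx x%:M y%:M *m col_mx u^T w^T == 0.
  by rewrite mul_row_col !mul_scalar_mx -!linearZ -linearD /= xy0 trmx0.
rewrite mulmx_free_eq0 // => /eqP;
  rewrite -row_mx0 => /eq_row_mx[/matrixP x0 /matrixP y0].
by have := (x0 0 0, y0 0 0); rewrite !mxE eqxx !mulr1n => -[].
Qed.

(** The default makes index [d] read as the zero vector, so that a single column is also a sum of
    two. *)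
Definition column p d (M : 'M[rat]_(p, d)) (i : nat) : 'cV[rat]_p :=
  oapp (fun x => col x M) 0 (insub i).

Lemma column_ord p d (M : 'M[rat]_(p, d)) (i : 'I_d) : column M i = col i M.
Proof. by rewrite /column valK. Qed.

Lemma column_out p d (M : 'M[rat]_(p, d)) : column M d = 0.
Proof. by rewrite /column insubN // ltnn. Qed.

Lemma col_mul p d c (M : 'M[rat]_(p, d)) (A : 'M[rat]_(d, c)) k :
  col k (M *m A) = \sum_(i < d) A i k *: column M i.
Proof.
apply/colP => x; rewrite !mxE summxE; apply: eq_bigr => i _.
by rewrite column_ord !mxE mulrC.
Qed.

Lemma sum_beq_column p d (M : 'M[rat]_(p, d)) y :
  \sum_(i < d) (beq i y)%:R *: column M i = column M y.
Proof.
rewrite {2}/column; case: insubP => [x lt_y xy | /negPf nlt_y] /=.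
  rewrite (bigD1 x) //= -xy /beq eqxx scale1r column_ord big1 ?addr0 // => i.
  by rewrite -val_eqE => /negPf ->; rewrite scale0r.
rewrite big1 // => i _; rewrite /beq; case: eqP => [iy|];
  last by rewrite scale0r.
by have := ltn_ord i; rewrite iy nlt_y.
Qed.

Lemma sum_double_ord (V : zmodType) (f : nat -> V) n :
  \sum_(i < 2 * n) f i = \sum_(l < n) (f (2 * l)%N + f (2 * l).+1).
Proof.
elim: n => [|n IH]; first by rewrite muln0 !big_ord0.
by rewrite [RHS]big_ord_recr /= -IH mulnS add2n !big_ord_recr /= addrA.
Qed.

Lemma ccons_dec k : (0 < k)%N -> ccons (dhd k) (dtl k) = k.
Proof.
rewrite -[k]CodeSeq.decodeK; case: (CodeSeq.decode k) => // i s _.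
by rewrite codeE dhd_ccons dtl_ccons.
Qed.

Lemma ltn_ccons i z : (z < ccons i z)%N.
Proof. by rewrite /ccons; have := expn_gt0 2 i; nia. Qed.

Lemma exp_le_ccons i z : (2 ^ i <= ccons i z)%N.
Proof. by rewrite /ccons leq_pmulr. Qed.

Section Columns.
Variable n : nat.
Let N := reg_num n.

Definition lin_rat (k l : nat) : rat := (int_of (lin_coef n k l))%:~R.

Definition left_vec p (h : nat -> 'cV[rat]_p) (k tag : nat) :=
  if tag == 5 then \sum_(l < N) lin_rat k l *: h (2 * l)%N
  else h (left1 n k tag) + h (left2 n k tag).
Definition right_vec p (h : nat -> 'cV[rat]_p) (k tag : nat) :=
  if tag == 5 then 0 else h (right1 n k tag) + h (right2 n k tag).

Lemma rank_entryE p (M : 'M[rat]_(p, 2 * N)) k tag :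
  \rank (M *m ratmx (\matrix_(i < 2 * N, c < 2) int_of (entry n k tag i c))) =
  rank2 (left_vec (column M) k tag) (right_vec (column M) k tag).
Proof.
have int_sum x y z : (int_of (2 * (beq x y + beq x z))%N)%:~R =
    (beq x y)%:R + (beq x z)%:R :> rat.
  by rewrite mul2n -[X in int_of X]/(code_int (Posz _)) code_intK -natrD.
rewrite mxrank2E !col_mul /left_vec /right_vec; congr (rank2 _ _).
  under eq_bigr => i _ do rewrite !mxE /entry /=.
  rewrite /beq; case: eqP => _ /=; rewrite -?/(beq _ _); last first.
    under eq_bigr => i _ do rewrite -!/(beq _ _) int_sum scalerDl.
    by rewrite big_split /= !sum_beq_column.
  rewrite (sum_double_ord
    (fun i => (int_of (cond (i %% 2) 0 (lin_coef n k (i %/ 2))))%:~R *: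
      column M i)).
  apply: eq_bigr => l _.
  have odd1 : ((2 * l).+1 %% 2 = 1)%N by rewrite mulnC -addn1 modnMDl.
  by rewrite modnMr mulKn // odd1 /= scale0r addr0.
under eq_bigr => i _ do rewrite !mxE /entry /=.
rewrite /beq; case: eqP => _ /=.
  by rewrite big1 // => i _; rewrite scale0r.
under eq_bigr => i _ do rewrite -!/(beq _ _) int_sum scalerDl.
by rewrite big_split /= !sum_beq_column.
Qed.

(** [v k] is meant as the value of the monomial with code [k]. For [k] beyond the number of
    equations the coefficients in the last condition are all zero. *)
Definition good_register (v : nat -> rat) : Prop :=
  [/\ v 0%N = 1,
      forall k, (0 < k < N)%N -> v k = v (2 ^ dhd k)%N * v (dtl k) &
      forall k, (k < N)%N -> \sum_(l < N) lin_rat k l * v l = 0].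

Lemma is_rank_system_to_rank : is_rank_constraint (system_to_rank n) <->
  exists p (M : 'M[rat]_(p, 2 * N)), \rank M = 2 /\
    forall k tag, (k < N)%N -> (tag < 6)%N ->
      rank2 (left_vec (column M) k tag) (right_vec (column M) k tag) =
      target_rank tag.
Proof.
rewrite is_rank_constraintP /= inord_rank //.
split=> -[p [M [Mr HM]]]; exists p, M; split=> //.
  move=> k tag lt_k lt_tag.
  have lt_t : (k * 6 + tag < N * 6)%N by lia.
  have := HM (Ordinal lt_t); rewrite /= inord_rank ?target_rank_le //.
  by rewrite rank_entryE !divmod_digit.
move=> t; rewrite inord_rank ?target_rank_le // rank_entryE HM ?ltn_pmod //.
by rewrite ltn_divLR.
Qed.

Lemma good_register_of_rank p (M : 'M[rat]_(p, 2 * N)) :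
  (forall k tag, (k < N)%N -> (tag < 6)%N ->
      rank2 (left_vec (column M) k tag) (right_vec (column M) k tag) =
      target_rank tag) ->
  exists v, good_register v.
Proof.
have N0 : (0 < N)%N by [].
set h := column M => HM.
have h_out : h (2 * N)%N = 0 by exact: column_out.
(* Constraint (0, 0) makes columns 0 and 1 independent; they serve as [e_0] and [e_1], and
   coefficients along them can be compared. *)
have free := rank2_eq2 (HM 0%N 0%N N0 isT).
rewrite /left_vec /right_vec /= /left1 /right1 /left2 /right2 /=
  h_out !addr0 in free.
have nz x y : (x != 0) || (y != 0) -> x *: h 0%N + y *: h 1%N != 0.
  by case/orP=> /eqP nz; apply/eqP => /free[].
have e0 : h 0%N != 0 by have := nz 1 0;
  rewrite scale1r scale0r addr0 oner_neq0; apply.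
have e1 : h 1%N != 0 by have := nz 0 1;
  rewrite scale1r scale0r add0r oner_neq0 orbT; apply.
have e01 : h 0%N + h 1%N != 0 by have := nz 1 1; rewrite !scale1r oner_neq0;
  apply.
have /fin_all_exists[a0 Ha0] (k : 'I_N) : exists a, h (2 * k)%N = a *: h 0%N.
  apply/(rank2_eq1 _ e0); have := HM k 1%N (ltn_ord k) isT.
  by rewrite /left_vec /right_vec /left1 /right1 /left2 /right2 /= h_out !addr0.
pose a l := oapp a0 0 (insub l).
have Ha k : (k < N)%N -> h (2 * k)%N = a k *: h 0%N.
  by move=> lt_k; rewrite /a insubT /= -Ha0.
have Hb k : (k < N)%N -> h (2 * k).+1 = a k *: h 1%N.
  move=> lt_k.
  have [b hb] : exists b, h (2 * k).+1 = b *: h 1%N.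
    apply/(rank2_eq1 _ e1); have := HM k 2 lt_k isT.
    by rewrite /left_vec /right_vec /left1 /right1 /left2 /right2 /=
      h_out !addr0.
  (* The relation [a_k e_0 + b e_1 = c (e_0 + e_1)] forces [a_k = c = b]. *)
  have /(rank2_eq1 _ e01)[c] := HM k 3 lt_k isT.
  rewrite /left_vec /left1 /left2 /= hb Ha // scalerDr => /eqP.
  rewrite -subr_eq0 opprD addrACA -!scalerBl => /eqP/free[/eqP + /eqP].
  by rewrite !subr_eq0 => /eqP -> /eqP ->.
have pow_lt k : (0 < k < N)%N -> (2 ^ dhd k < N)%N /\ (dtl k < N)%N.
  case/andP=> k0 lt_k; split; apply: leq_ltn_trans lt_k;
    rewrite -[leqRHS]ccons_dec //.
    exact: exp_le_ccons.
  exact/ltnW/ltn_ccons.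
exists a; split=> [|k kN|k lt_k].
- have /eqP := Ha 0%N N0; rewrite muln0 -subr_eq0 -{1}[h 0%N]scale1r -scalerBl.
  by rewrite scaler_eq0 (negPf e0) orbF subr_eq0 => /eqP.
- have [lt_p lt_z] := pow_lt k kN; have /andP[k0 lt_k] := kN.
  have nz4 : h 0%N + h (2 * 2 ^ dhd k).+1 != 0.
    by rewrite Hb // -{1}[h 0%N]scale1r; apply: nz; rewrite oner_neq0.
  (* With [z = dtl k] and [i = dhd k], the relation [a_z e_0 + a_k e_1 = c (e_0 + a_(2 ^ i) e_1)]
     gives [c = a_z], then [a_k = a_z a_(2 ^ i)]. *)
  have := HM k 4 lt_k isT.
  rewrite /left_vec /right_vec /left1 /right1 /left2 /right2 /=.
  have -> : cond k (2 ^ dhd k) 0 = (2 ^ dhd k)%N by case: (k) k0.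
  move/(rank2_eq1 _ nz4) => -[c]; rewrite Ha // !Hb // scalerDr scalerA => /eqP.
  rewrite -subr_eq0 opprD addrACA -!scalerBl => /eqP/free[/eqP + /eqP].
  by rewrite !subr_eq0 => /eqP -> /eqP ->; rewrite mulrC.
have := HM k 5 lt_k isT; rewrite /left_vec /right_vec /= => /rank2_eq0.
under eq_bigr => l _ do rewrite Ha // scalerA.
by rewrite -scaler_suml => /eqP; rewrite scaler_eq0 (negPf e0) orbF => /eqP.
Qed.

Lemma rank_of_good_register v : good_register v ->
  exists M : 'M[rat]_(2, 2 * N), \rank M = 2 /\
    forall k tag, (k < N)%N -> (tag < 6)%N ->
      rank2 (left_vec (column M) k tag) (right_vec (column M) k tag) =
      target_rank tag.
Proof.
have N0 : (0 < N)%N by [].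
case=> v0 vM vlin.
(* Here [e_0] and [e_1] are the standard basis, and the parity of the column index selects the
   coordinate. *)
pose M : 'M[rat]_(2, 2 * N) :=
  \matrix_(x, y) (if (y %% 2 == x)%N then v (y %/ 2)%N else 0).
set h := column M.
pose e0 : 'cV[rat]_2 := delta_mx ord0 0; pose e1 : 'cV[rat]_2 :=
  delta_mx ord_max 0.
have h_out : h (2 * N)%N = 0 by exact: column_out.
have hE k b : (k < N)%N -> (b < 2)%N ->
    h (k * 2 + b)%N = \col_x (if (b == x)%N then v k else 0).
  move=> lt_k lt_b; rewrite /h /column insubT ?[(2 * N)%N]mulnC; first by lia.
  by move=> lt_kb; apply/colP => x; rewrite !mxE /= !divmod_digit.
have Ha k : (k < N)%N -> h (2 * k)%N = v k *: e0.
  move=> lt_k; rewrite mulnC -[(k * 2)%N]addn0 hE //; apply/colP => x;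
    rewrite !mxE.
  by case: x => [[|[|]]] //= _; rewrite ?mulr1 ?mulr0.
have Hb k : (k < N)%N -> h (2 * k).+1 = v k *: e1.
  move=> lt_k; rewrite mulnC -[(k * 2).+1]addn1 hE //; apply/colP => x;
    rewrite !mxE.
  by case: x => [[|[|]]] //= _; rewrite ?mulr1 ?mulr0.
have h0 : h 0%N = e0 by rewrite -[h _]/(h (2 * 0)%N) Ha // v0 scale1r.
have h1 : h 1%N = e1 by rewrite -[h _]/(h (2 * 0).+1) Hb // v0 scale1r.
have rk01 : rank2 e0 e1 = 2.
  rewrite -[RHS](mxrank1 rat 2) mxrank2E; congr (rank2 _ _);
    by apply/colP => x; rewrite !mxE ?eqxx ?andbT.
have nz x y : (x != 0) || (y != 0) -> x *: e0 + y *: e1 != 0.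
  by case/orP=> /eqP nz; apply/eqP => /(rank2_eq2 rk01)[].
have e0n : e0 != 0 by have := nz 1 0; rewrite scale1r scale0r addr0 oner_neq0;
  apply.
have e1n : e1 != 0 by have := nz 0 1;
  rewrite scale1r scale0r add0r oner_neq0 orbT; apply.
have e01n : e0 + e1 != 0 by have := nz 1 1; rewrite !scale1r oner_neq0; apply.
exists M; split.
  apply/eqP; rewrite eqn_leq rank_leq_row /=.
  have := rank_entryE M 0 0; rewrite -/h /left_vec /right_vec /left1 /right1
    /left2 /right2 /=.
  by rewrite h_out !addr0 h0 h1 rk01 => {1}<-; exact: mxrankM_maxl.
move=> k tag lt_k; rewrite -/h.
rewrite /left_vec /right_vec /left1 /right1 /left2 /right2.
case: tag => [|[|[|[|[|[|]]]]]] //= _; rewrite ?h_out ?addr0 ?h0 ?h1 //.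
- by apply/(rank2_eq1 _ e0n); exists (v k); rewrite Ha.
- by apply/(rank2_eq1 _ e1n); exists (v k); rewrite Hb.
- by apply/(rank2_eq1 _ e01n); exists (v k); rewrite Ha // Hb // scalerDr.
(* There is no product rule for [k = 0]: both vectors of this constraint are then [e_0 + e_1]. *)
- case: k lt_k => [|k] lt_k.
    have -> : dtl 0 = 0%N by rewrite /dtl !div0n.
    by rewrite muln0 h0 h1; apply/(rank2_eq1 _ e01n); exists 1; rewrite scale1r.
  have kN : (0 < k.+1 < N)%N by [].
  have [lt_p lt_z] : (2 ^ dhd k.+1 < N)%N /\ (dtl k.+1 < N)%N.
    split; apply: leq_ltn_trans lt_k; rewrite -[leqRHS]ccons_dec //.
      exact: exp_le_ccons.
    exact/ltnW/ltn_ccons.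
  rewrite Ha // !Hb //; apply/rank2_eq1.
    by rewrite -{1}[e0]scale1r; apply: nz; rewrite oner_neq0.
  by exists (v (dtl k.+1)); rewrite scalerDr scalerA (vM _ kN) mulrC.
apply/rank2_eq0; under eq_bigr => l _ do rewrite Ha // scalerA.
by rewrite -scaler_suml vlin // scale0r.
Qed.

Lemma system_to_rankP : is_rank_constraint (system_to_rank n) <->
  exists v, good_register v.
Proof.
rewrite is_rank_system_to_rank; split=> [[p [M [_ HM]]] | [v Hv]].
  exact: good_register_of_rank HM.
by exists 2; exact: rank_of_good_register Hv.
Qed.

End Columns.

(** Prepending letter [i] multiplies the value by [v (2 ^ i)]. Codes grow along the way, so the
    bound on the final word covers the intermediate ones. *)
Lemma word_val (v : nat -> rat) N e : v 0%N = 1 ->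
  (forall k, (0 < k < N)%N -> v k = v (2 ^ dhd k)%N * v (dtl k)) ->
  (word e < N)%N -> v (word e) = \prod_(i < dsize e) v (2 ^ i)%N ^+ dnth e i.
Proof.
move=> v0 vM.
have step i z c : (z <= prec z (fun=> ccons i) c)%N /\
    ((prec z (fun=> ccons i) c < N)%N ->
     v (prec z (fun=> ccons i) c) = v z * v (2 ^ i)%N ^+ c).
  elim: c => [|c [le_z IH]] /=; first by rewrite mulr1.
  set y := prec _ _ c in le_z IH *; have lt_y := ltn_ccons i y.
  split=> [|lt_N]; first exact/ltnW/(leq_ltn_trans le_z).
  rewrite vM; last by rewrite lt_N andbT (leq_ltn_trans _ lt_y).
  by rewrite dhd_ccons dtl_ccons IH ?(ltn_trans lt_y) // exprS mulrCA.
rewrite /word; elim: (dsize e) => [|m IH] /=; first by rewrite big_ord0.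
set y := prec 0 _ m in IH *; have [le_y Hy] := step m y (dnth e m).
by move=> lt_N; rewrite big_ord_recr /= -IH ?Hy // (leq_ltn_trans le_y).
Qed.

Section System.
Variable S : poly_system.
Let n := code_poly_system S.
Let q := ps_q S.
Let eqs := ps_eqs S.

Lemma eq_numE : eq_num n = size eqs.
Proof. by rewrite /eq_num /n /code_poly_system dnth_code dsize_code size_map.
Qed.

Section Equation.
Variable s : nat.
Hypothesis lt_s : (s < size eqs)%N.
Let ts := nth [::] eqs s.

Lemma dnth_eqs : dnth (dnth n 1) s = code_terms ts.
Proof. by rewrite /n /code_poly_system !dnth_code (nth_map [::]). Qed.

Lemma term_numE : term_num n s = size ts.
Proof. by rewrite /term_num dnth_eqs dsize_code size_map. Qed.

Let tm t : rat * 'X_{1..q} := nth (0, 0%MM) ts t.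

Lemma termE t : (t < size ts)%N -> term n s t =
  CodeSeq.code [:: code_rat (tm t).1; CodeSeq.code ((tm t).2 : q.-tuple nat)].
Proof. by move=> lt_t; rewrite /term dnth_eqs dnth_code (nth_map (0, 0%MM)).
Qed.

Lemma term_numerE t : (t < size ts)%N ->
  term_numer n s t = code_int (numq (tm t).1).
Proof. by move=> lt_t; rewrite /term_numer termE // !dnth_code. Qed.

Lemma term_denomE t : (t < size ts)%N ->
  Posz (term_denom n s t) = denq (tm t).1.
Proof.
move=> lt_t; rewrite /term_denom termE // !dnth_code.
by case: (denq _) (denq_gt0 (tm t).1) => // m _; rewrite /= -mul2n mulKn.
Qed.

Lemma term_word_lt t : (t < size ts)%N -> (term_word n s t < reg_num n)%N.
Proof.
move=> lt_t; rewrite /reg_num ltnS; apply: leq_trans (leq_addl _ _).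
have lt_s' : (s < eq_num n)%N by rewrite eq_numE.
have lt_t' : (t < term_num n s)%N by rewrite term_numE.
rewrite /sumf (bigD1 (Ordinal lt_s')) //= (bigD1 (Ordinal lt_t')) //= -addnA.
by rewrite addSn leqW ?leq_addr.
Qed.

Section Registers.
Variable v : nat -> rat.
Hypotheses (v0 : v 0%N = 1) (vM : forall k,
  (0 < k < reg_num n)%N -> v k = v (2 ^ dhd k)%N * v (dtl k)).

Lemma term_word_val t : (t < size ts)%N ->
  v (term_word n s t) = \prod_(i < q) v (2 ^ i)%N ^+ (tm t).2 i.
Proof.
move=> lt_t; have := term_word_lt lt_t; rewrite /term_word => /(word_val v0 vM)
  ->.
rewrite termE // !dnth_code dsize_code size_tuple.
by apply: eq_bigr => i _; rewrite dnth_code -tnth_nth.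
Qed.

Definition num_coef t : int :=
  numq (tm t).1 * \prod_(t' < size ts | t' != t :> nat) denq (tm t').1.

Lemma num_coefE (t : 'I_(size ts)) :
  (num_coef t)%:~R =
  (\prod_(t' < size ts) denq (tm t').1)%:~R * (tm t).1 :> rat.
Proof.
rewrite /num_coef [in RHS](bigD1 t) //= !intrM mulrAC; congr (_ * _).
by rewrite [RHS]mulrC -[X in _ = X * _]divq_num_den mulfVK // intr_eq0
  denq_neq0.
Qed.

(** Contributions are collected by sign in two natural numbers and subtracted; the sign of a
    coefficient is the parity of the code of its numerator. *)
Lemma lin_coefE l : int_of (lin_coef n s l) =
  \sum_(t < size ts | term_word n s t == l) num_coef t.
Proof.
rewrite /lin_coef int_of_code_sub
  /sumf term_numE !(big_morph Posz PoszD (erefl _)).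
rewrite -sumrB [RHS]big_mkcond; apply: eq_bigr => t _ /=.
have absE : Posz (term_abs n s t) =
    `|numq (tm t).1| * \prod_(t' < size ts | t' != t :> nat) denq (tm t').1.
  rewrite /term_abs PoszM term_numerE // term_numE; congr (_ * _).
    by rewrite modn2 divn2; case: (numq _) => m /=;
      rewrite odd_double /= ?doubleK ?uphalf_double.
  rewrite /prodf (big_morph Posz PoszM (erefl _)) [RHS]big_mkcond.
  by apply: eq_bigr => t' _; rewrite /beq; case: eqP => //= _;
    rewrite term_denomE.
rewrite /beq; case: eqP => _; rewrite ?mul0n ?subr0 // !mul1n /num_coef.
rewrite term_numerE // modn2; move: absE.
case: (numq _) => m /=; rewrite odd_double /= => ->; rewrite ?subr0 //.
by rewrite sub0r -mulNr NegzE.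
Qed.

(** Terms with the same monomial share a register; exchanging the sums over registers and terms
    recovers the polynomial, up to the common denominator. *)
Lemma lin_rat_sum :
  \sum_(l < reg_num n) lin_rat n s l * v l =
  (\prod_(t' < size ts) denq (tm t').1)%:~R *
    (poly_of_terms ts).@[fun i : 'I_q => v (2 ^ i)%N].
Proof.
transitivity (\sum_(t < size ts) (num_coef t)%:~R * v (term_word n s t)).
  under eq_bigr => l _ do
    rewrite /lin_rat lin_coefE rmorph_sum mulr_suml /= big_mkcond /=.
  rewrite exchange_big /=; apply: eq_bigr => t _.
  rewrite (bigD1 (Ordinal (term_word_lt (ltn_ord t)))) //= eqxx.
  rewrite big1 ?addr0 // => l.
  by rewrite -val_eqE /= eq_sym => /negPf ->.
rewrite /poly_of_terms (big_nth (0, 0%MM)) big_mkord raddf_sum mulr_sumr.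
apply: eq_bigr => t _; rewrite /= mevalZ mevalX num_coefE mulrA.
by rewrite term_word_val.
Qed.

End Registers.
End Equation.

Lemma good_registerP (v : nat -> rat) : v 0%N = 1 ->
  (forall k, (0 < k < reg_num n)%N -> v k = v (2 ^ dhd k)%N * v (dtl k)) ->
  good_register n v <->
  forall ts, ts \in eqs ->
    (poly_of_terms ts).@[fun i : 'I_q => v (2 ^ i)%N] = 0.
Proof.
move=> v0 vM; split=> [[_ _ Hlin] ts ts_eqs | Hts].
  have lt_s : (index ts eqs < size eqs)%N by rewrite index_mem.
  have lt_N : (index ts eqs < reg_num n)%N.
    by rewrite /reg_num ltnS eq_numE (leq_trans (ltnW lt_s)) ?leq_addr.
  have /eqP := lin_rat_sum lt_s v0 vM.
  rewrite Hlin // eq_sym mulf_eq0 intr_eq0 nth_index // => /orP[|/eqP //].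
  by move/prodf_eq0 => [t _]; rewrite (negPf (denq_neq0 _)).
split=> // s _; case: (ltnP s (size eqs)) => [lt_s | le_s].
  by rewrite lin_rat_sum // Hts ?mulr0 // mem_nth.
rewrite big1 // => l _; rewrite /lin_rat /lin_coef /term_num.
(* Past the list of equations the reading yields 0, the code of a polynomial without terms. *)
have -> : dnth (dnth n 1) s = 0%N.
  by rewrite /n /code_poly_system !dnth_code nth_default // size_map.
by rewrite (dsize_code [::]) /sumf !big_ord0 /= mul0r.
Qed.

Lemma good_register_solution :
  (exists v, good_register n v) <-> has_rational_solution S.
Proof.
split=> [[v Hv] | [a Ha]].
  have [v0 vM _] := Hv; exists (fun i => v (2 ^ i)%N).
  exact/(good_registerP v0 vM).
pose x i := oapp a 0 (insub i).
(* Each register holds the product of the letters of its word; variable [i] sits at [2 ^ i], the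
   code of the one-letter word. *)
pose v k := \prod_(i <- CodeSeq.decode k) x i.
have v_ccons i z : v (ccons i z) = x i * v z.
  by rewrite /v -{1}[z]CodeSeq.decodeK -codeE CodeSeq.codeK big_cons.
have v0 : v 0%N = 1 by rewrite /v big_nil.
have v_pow i : v (2 ^ i)%N = x i.
  by rewrite -[(2 ^ i)%N]muln1 -[(2 ^ i * 1)%N]/(ccons i 0) v_ccons v0 mulr1.
have vM k : (0 < k < reg_num n)%N -> v k = v (2 ^ dhd k)%N * v (dtl k).
  by case/andP=> k0 _; rewrite -{1}(ccons_dec k0) v_ccons v_pow.
exists v; apply/(good_registerP v0 vM) => ts /Ha <-.
by apply: meval_eq => i; rewrite v_pow /x valK.
Qed.

End System.

Lemma rank_decides_system :
  effectively_decidable code_rank_instance is_rank_constraint ->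
  effectively_decidable code_poly_system has_rational_solution.
Proof.
apply: (reduction_decidable
  (F := fun n => code_rank_instance (system_to_rank n))
  (r := fun S => system_to_rank (code_poly_system S))) => [|//|S].
  exact: rc_system_to_rank.
by rewrite system_to_rankP good_register_solution.
Qed.

Theorem theorem5p9 :
  effectively_decidable code_rank_instance is_rank_constraint <->
  effectively_decidable code_poly_system has_rational_solution.
Proof. by split; [exact: rank_decides_system | exact: system_decides_rank]. Qed.
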